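(* Let $p,q\ge2$ be integers and suppose $(\beta,h)\in\Theta$ is regular. Assume $\beta$ is known and $\boldsymbol X\sim\mathbb P_{\beta,h,N}$. Let $\boldsymbol m_*=\boldsymbol x_s$ be the unique maximizer of $H_{\beta,h}$. Then, as $N\to\infty$, the maximum likelihood estimator $\hat h_N$ of $h$ satisfies $$N^{1/2}\left(\hat h_N-h\right)\xrightarrow{D}\mathcal N\left(0,\,-\frac{q^2}{(q-1)^2}f''_{\beta,h}(s)\right).$$
   Context: For real $\beta,h$ and $N\ge1$, $\mathbb P_{\beta,h,N}$ is the probability measure on $\{1,\dots,q\}^N$ with $\mathbb P_{\beta,h,N}(\boldsymbol X)\propto\exp\left(\beta N\sum_{r=1}^q\bar X_{\cdot r}^p+Nh\bar X_{\cdot1}\right)$, where $\bar X_{\cdot r}=N^{-1}\#\{i:X_i=r\}$; $\mathbb E_{\beta,h,N}$ is its expectation. $\Theta=(0,\infty)\times[0,\infty)$. For known $\beta$ and one sample $\boldsymbol X$, $\hat h_N$ maximizes the likelihood $h'\mapsto\mathbb P_{\beta,h',N}(\boldsymbol X)$ over $h'\in\mathbb R$; equivalently it is the solution in $h'$ of $\mathbb E_{\beta,h',N}(\bar X_{\cdot1})=\bar X_{\cdot1}$ (the left side is strictly increasing in $h'$; if there is no finite solution, $\hat h_N=\pm\infty$ according to where the supremum of the likelihood is approached). On the set $\mathcal P_q$ of probability vectors in $\mathbb R^q$, $H_{\beta,h}(\boldsymbol t)=\beta\sum_r t_r^p+ht_1-\sum_r t_r\log t_r$. For $s\in[0,1]$,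 $\boldsymbol x_s=\left(\frac{1+(q-1)s}{q},\frac{1-s}{q},\dots,\frac{1-s}{q}\right)$ and $f_{\beta,h}(s)=H_{\beta,h}(\boldsymbol x_s)$. A unique global maximizer of $H_{\beta,h}$ is of the form $\boldsymbol x_s$, $s\in[0,1)$. The point $(\beta,h)$ is regular if $H_{\beta,h}$ has a unique global maximizer $\boldsymbol m_*$ and $\boldsymbol Q_{\boldsymbol m_*,\beta}(\boldsymbol t)=\sum_{r=1}^q\left(\beta p(p-1)m_{*,r}^{p-2}-\frac1{m_{*,r}}\right)t_r^2$ is negative definite on $\mathcal H_q=\{\boldsymbol t\in\mathbb R^q:\sum_r t_r=0\}$. *)

(* Defs.v *)
From HB Require Import structures.
From mathcomp Require Import all_boot all_order all_algebra.
From mathcomp Require Import all_classical all_reals all_analysis.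
Set Implicit Arguments.
Unset Strict Implicit.
Unset Printing Implicit Defensive.
Import Order.TTheory GRing.Theory Num.Theory.
Import numFieldNormedType.Exports.
Local Open Scope classical_set_scope.
Local Open Scope ring_scope.

(* Colours are elements of 'I_q; throughout, c : 'I_q is the colour on which
   the external field h acts (the first coordinate). *)

Definition config (q N : nat) := {ffun 'I_N -> 'I_q}.

Definition color_freq (R : realType) (q N : nat) (X : config q N) (r : 'I_q) :
    R :=
  #|[set i : 'I_N | X i == r]%SET|%:R / N%:R.

Definition gibbs_weight (R : realType) (p q : nat) (c : 'I_q) (beta h : R)
    (N : nat) (X : config q N) : R :=
  expR (beta * N%:R * (\sum_(r < q) color_freq R X r ^+ p)
        + N%:R * h * color_freq R X c).

Definition gibbs (R : realType) (p q : nat) (c : 'I_q) (beta h : R)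
    (N : nat) (X : config q N) : R :=
  gibbs_weight p c beta h X
  / \sum_(Y : config q N) gibbs_weight p c beta h Y.

(* The estimate is infinite only if the likelihood has no real maximizer; its
   sign then tells at which end the supremum is approached. *)
Definition is_mle (R : realType) (p q : nat) (c : 'I_q) (beta : R)
    (N : nat) (X : config q N) (e : \bar R) : Prop :=
  let L := fun h' : R => gibbs p c beta h' X in
  let is_max := fun a : R => forall h' : R, L h' <= L a in
  match e with
  | a%:E => is_max a
  | +oo%E => (~ exists a, is_max a) /\ L h' @[h' --> +oo] --> sup (range L)
  | -oo%E => (~ exists a, is_max a) /\ L h' @[h' --> -oo] --> sup (range L)
  end.

(* For N >= 1 and q >= 2 exactly one extended real satisfies is_mle, so the
   default value 0 is never used there. *)
Definition mle (R : realType) (p q : nat) (c : 'I_q) (beta : R)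
    (N : nat) (X : config q N) : \bar R :=
  xget 0%E [set e | is_mle p c beta X e].

(* Convergence in distribution to mu of (extended) real random variables Y N
   on the finite probability spaces (T N, P N): the distribution functions
   converge at every continuity point of that of mu. As mu is a probability on
   the real line, no mass is lost at infinity. *)
Definition cvg_in_distribution (R : realType) (T : nat -> finType)
    (P : forall N, T N -> R) (Y : forall N, T N -> \bar R)
    (mu : probability (measurableTypeR R) R) : Prop :=
  forall x : R,
    {for x, continuous (fun y : R => mu `]-oo, y]%classic)} ->
    (\sum_(w : T N | (Y N w <= x%:E)%E) P N w)%:E @[N --> \oo]
      --> mu `]-oo, x]%classic.

Definition simplex (R : realType) (q : nat) : set 'rV[R]_q :=
  [set t | (forall r, 0 <= t ord0 r) /\ \sum_(r < q) t ord0 r = 1].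

(* 0 * ln 0 = 0, as usual. *)
Definition free_energy (R : realType) (p q : nat) (c : 'I_q) (beta h : R)
    (t : 'rV[R]_q) : R :=
  beta * (\sum_(r < q) t ord0 r ^+ p) + h * t ord0 c
  - \sum_(r < q) t ord0 r * ln (t ord0 r).

Definition global_maximizer (R : realType) (p q : nat) (c : 'I_q) (beta h : R)
    (m : 'rV[R]_q) : Prop :=
  simplex m /\
  forall t : 'rV[R]_q, simplex t ->
    free_energy p c beta h t <= free_energy p c beta h m.

Definition unique_global_maximizer (R : realType) (p q : nat) (c : 'I_q)
    (beta h : R) (m : 'rV[R]_q) : Prop :=
  global_maximizer p c beta h m /\
  forall t : 'rV[R]_q, global_maximizer p c beta h t -> t = m.

Definition hessian_form (R : realType) (p q : nat) (m : 'rV[R]_q) (beta : R)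
    (t : 'rV[R]_q) : R :=
  \sum_(r < q) (beta * p%:R * (p%:R - 1) * m ord0 r ^+ (p - 2)
                - (m ord0 r)^-1) * t ord0 r ^+ 2.

Definition regular_point (R : realType) (p q : nat) (c : 'I_q) (beta h : R) :
    Prop :=
  exists m : 'rV[R]_q,
    unique_global_maximizer p c beta h m /\
    forall t : 'rV[R]_q, \sum_(r < q) t ord0 r = 0 -> t != 0 ->
      hessian_form p m beta t < 0.

Definition x_point (R : realType) (q : nat) (c : 'I_q) (s : R) : 'rV[R]_q :=
  \row_(r < q) (if r == c then (1 + (q%:R - 1) * s) / q%:R
                else (1 - s) / q%:R).

(* This is used on [0, 1), but the formula is smooth on (-1/(q-1), 1), so its
   two-sided derivatives at s = 0 are the one-sided ones. *)
Definition f_line (R : realType) (p q : nat) (c : 'I_q) (beta h : R) (s : R) :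
    R :=
  free_energy p c beta h (x_point c s).

(* Main.v *)
Require Import Defs.
From HB Require Import structures.
From mathcomp Require Import all_boot all_order all_algebra.
From mathcomp Require Import all_classical all_reals all_analysis.
From mathcomp Require Import ring lra zify.
Set Implicit Arguments.
Unset Strict Implicit.
Unset Printing Implicit Defensive.
Import Order.TTheory GRing.Theory Num.Theory.
Import numFieldNormedType.Exports.
Local Open Scope classical_set_scope.
Local Open Scope ring_scope.

(** Write t for the frequency of the colour c, (a, b, ..., b) for the maximizer
of the free energy H and W = sqrt N (t - a). The log-likelihood is strictly
concave with derivative N (t - E_h' t), so the estimate is at most h' exactly
when t <= E_h' t ([mle_le]). The distribution function of sqrt N (estimate - h)
at x is therefore the probability, in the field h, that W is at most the mean of
W in the field h + x / sqrt N. With kappa = - q^2 / (q - 1)^2 f''(s)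
([f_line_second]), two facts give the theorem: kappa times this mean tends to x
([cvg_mean_response]), and kappa W tends in law to a centred normal variable of
variance kappa ([cvg_cdf_fluct]).

Both facts are instances of one asymptotic identity, valid for functions g of
exponential growth that may depend on N ([cvg_stein]):
  E_h [sqrt N (g W - g (W - 1 / sqrt N)) - kappa W g W] -> 0.
It starts from an exact one. Recolouring one site from c to r maps the
configurations where the site has colour c onto those where it has colour r and
multiplies the Gibbs weight by a factor that depends on the frequencies only
([swap_identity]). That factor is linearized at the maximizer
([jump_estimate]): stationarity of H cancels the constant terms, and because all
colours other than c have the same frequency b at the maximizer, the sum of the
linear terms over these colours is a multiple of t - a alone.

The error terms need concentration, which is obtained without asymptotic
formulas for multinomial coefficients. The powers are convex, so replacing them
by their tangents at the maximizer m bounds the partition function from below by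
exp (N H(m)) ([partition_ge]). The total weight of the configurations with
frequencies t is at most exp (N H(t)) ([type_weight_le]), H(t) is at most
H(m) - k |t - m|^2 ([free_energy_quadratic]), and there are only (N + 1)^q
vectors of frequencies. Hence the exponential moments of sqrt N |t - m| are
o(sqrt N) ([cvg_exp_dev]). This is far from sharp but sufficient, as the errors
in the identity carry a factor 1 / sqrt N.

For the first fact take g = exp (x .), because passing from h to h + x / sqrt N
tilts the law of W by exp (x W) ([gibbs_mean_tilt]). For the second take the
solution of Stein's equation for a half-line ([stein_solution]). It has a corner
at the end of the half-line, but W takes its values in a lattice of step
1 / sqrt N: if the half-line ends at a lattice point, no step of length
1 / sqrt N jumps over the corner, and no smoothing is needed. *)

(** * Real analysis *)

Lemma sumr_neq_const (R : realType) (q : nat) (c : 'I_q) (x : R) :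
  \sum_(r < q | r != c) x = (q%:R - 1) * x.
Proof.
have := cardC1 c; rewrite card_ord => cardc.
rewrite sumr_const (_ : #|[pred r | r != c]| = q.-1)// -[LHS]mulr_natl.
by rewrite -subn1 natrB// (leq_ltn_trans _ (ltn_ord c)).
Qed.

Lemma cvg_sumr (R : realType) (I T : Type) (F : set_system T) (FF : Filter F)
    (r : seq I) (P : pred I) (f : I -> T -> R) (l : I -> R) :
  (forall i, P i -> f i x @[x --> F] --> l i) ->
  \sum_(i <- r | P i) f i x @[x --> F] --> \sum_(i <- r | P i) l i.
Proof. by move=> fl; apply: cvg_big => //; exact: add_continuous. Qed.

Lemma near_le_ln (R : realType) (M : R) : \forall N \near \oo, M <= ln N.+1%:R.
Proof.
exists (Num.truncn (expR M)).+1 => // N /= MN.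
rewrite -ler_expR lnK ?posrE ?ltr0n// ltW// (lt_le_trans (truncnS_gt _))//.
by rewrite ler_nat (leq_trans MN).
Qed.

Lemma cvg_sqrtnV (R : realType) :
  (Num.sqrt N%:R)^-1 @[N --> \oo] --> (0 : R).
Proof.
apply/cvgrPdist_le => e e0; exists (Num.truncn (e ^- 2)).+1 => // N /= eN.
have N0 : 0 < N%:R :> R by rewrite ltr0n (leq_trans _ eN).
rewrite sub0r normrN ger0_norm ?invr_ge0 ?sqrtr_ge0//.
rewrite -[leRHS]invrK lef_pV2 ?posrE ?sqrtr_gt0 ?invr_gt0//.
rewrite -(@ler_pXn2r _ 2) ?nnegrE ?invr_ge0 ?sqrtr_ge0 ?(ltW e0)//.
rewrite sqr_sqrtr ?(ltW N0)// exprVn ltW// (lt_le_trans (truncnS_gt _))//.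
by rewrite ler_nat.
Qed.

Lemma cvgn_scale0 (R : realType) (k : R) (u : nat -> R) :
  u N @[N --> \oo] --> (0 : R) -> k * u N @[N --> \oo] --> (0 : R).
Proof. by move=> u0; rewrite -[X in _ --> X](mulr0 k); exact: cvgMl_tmp. Qed.

Lemma mvt_segment (R : realType) (f df : R -> R) (a b : R) : a <= b ->
  (forall x, a <= x <= b -> is_derive x 1 f (df x)) ->
  exists2 c, a <= c <= b & f b - f a = df c * (b - a).
Proof.
move=> ab fd; have [c| |c cab ->] := @MVT_segment R f df a b ab.
- by rewrite in_itv/= => /andP[/ltW ac /ltW cb]; apply: fd; rewrite ac.
- apply: derivable_within_continuous => x; rewrite in_itv/= => xab.
  by have [] := fd _ xab.
by exists c => //; move: cab; rewrite in_itv.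
Qed.

Section calculus.
Context (R : realType).

Section derivation_rules.
Context (x : R) (f g : R -> R) (a b : R).
Hypotheses (fa : is_derive x 1 f a) (gb : is_derive x 1 g b).

Lemma is_derive_add : is_derive x 1 (fun y => f y + g y) (a + b).
Proof. exact: is_deriveD. Qed.

Lemma is_derive_sub : is_derive x 1 (fun y => f y - g y) (a - b).
Proof. exact: is_deriveB. Qed.

Lemma is_derive_scale (k : R) : is_derive x 1 (fun y => k * f y) (k * a).
Proof. exact: is_deriveZ. Qed.

Lemma is_derive_mul : is_derive x 1 (fun y => f y * g y) (f x * b + g x * a).
Proof. exact: is_deriveM. Qed.

Lemma is_derive_exprn n :
  is_derive x 1 (fun y => f y ^+ n) (n%:R * f x ^+ n.-1 * a).
Proof.
have -> : (fun y => f y ^+ n) = f ^+ n by apply/funext => y; rewrite exprfctE.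
exact: is_deriveX.
Qed.
End derivation_rules.

Lemma natr_exprn_pred (n : nat) (y : R) :
  n%:R * ((n - 1)%:R * y ^+ (n - 1).-1) = n%:R * (n%:R - 1) * y ^+ (n - 2).
Proof.
case: n => [|[|n]]; first by rewrite !mul0r.
  by rewrite subnn subrr !(mul0r, mulr0).
rewrite subn1 subn2 /= (_ : n.+1%:R = n.+2%:R - 1 :> R); first by ring.
by rewrite -[in RHS]natr1 addrK.
Qed.

(** Taylor's formula of order two as an upper bound, for a function whose
derivative is differentiable at one point only: the derivative of the difference
of the two sides changes sign at m. *)
Lemma taylor2_upper (f f' : R -> R) (m l k : R) :
  (\forall u \near m, is_derive (u : R) 1 f (f' u)) -> is_derive m 1 f' l -> l
    < k ->
  \forall u \near m, f u <= f m + f' m * (u - m) + k / 2 * (u - m) ^+ 2.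
Proof.
move=> fd f'd lk.
have slope : \forall u \near m, u != m -> (u - m)^-1 * (f' u - f' m) < k.
  have : h^-1 *: ((f' \o shift m) (h *: (1 : R)) - f' m) @[h --> 0^'] --> l.
    by have [d <-] := f'd; exact: d.
  move=> /cvgr_lt/(_ _ lk); rewrite near_withinE => /nbhs_ballP[e e0 He].
  apply/nbhs_ballP; exists e => // u /= um umN.
  have := He (u - m); rewrite /= /GRing.scale/= mulr1 subrK; apply.
    by rewrite /ball/= sub0r normrN distrC.
  by rewrite subr_eq0.
have /nbhs_ballP[e e0 He] : \forall u \near m, is_derive (u : R) 1 f (f' u) /\
    (u != m -> (u - m)^-1 * (f' u - f' m) < k) by exact: filterI.
apply/nbhs_ballP; exists e => // u um.
pose g (v : R) := f v - (f' m * v + k / 2 * (v - m) ^+ 2).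
have dg (v : R) : ball m e v -> is_derive v 1 g (f' v - f' m - k * (v - m)).
  move=> /He[dfv _]; rewrite /g.
  apply: (is_derive_eq (is_derive_sub dfv (is_derive_add
    (is_derive_scale (is_derive_id v 1) (f' m)) (is_derive_scale
    (is_derive_exprn (is_derive_sub (is_derive_id v 1) (is_derive_cst m v 1)) 2)
    (k / 2))))).
  by rewrite /= expr1; field.
have sl v : ball m e v -> v != m -> (v - m)^-1 * (f' v - f' m) < k.
  by move=> /He[].
suff : g u <= g m by rewrite /g subrr; lra.
move: um; rewrite /ball/= => um.
have [mu|um'|->//] := ltgtP m u.
- have [v /andP[mv vu]|v /andP[mv vu]] := @mvt_segment _ g
    (fun v => f' v - f' m - k * (v - m)) m u (ltW mu).
    apply: dg; rewrite /ball/=; move: um; rewrite !ltr_norml; lra.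
  rewrite -subr_le0 => ->; rewrite pmulr_lle0 ?subr_gt0// subr_le0.
  have [->|vm] := eqVneq v m; first by rewrite !subrr mulr0.
  have bv : ball m e v by rewrite /ball/=; move: um; rewrite !ltr_norml; lra.
  have := sl v bv vm; rewrite ltr_pdivrMl ?subr_gt0 ?lt_neqAle 1?eq_sym ?vm//.
  by move=> h; lra.
- have [v /andP[mv vu]|v /andP[mv vu]] := @mvt_segment _ g
    (fun v => f' v - f' m - k * (v - m)) u m (ltW um').
    apply: dg; rewrite /ball/=; move: um; rewrite !ltr_norml; lra.
  rewrite -subr_ge0 => ->; rewrite pmulr_lge0 ?subr_gt0// subr_ge0.
  have [->|vm] := eqVneq v m; first by rewrite !subrr mulr0.
  have bv : ball m e v by rewrite /ball/=; move: um; rewrite !ltr_norml; lra.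
  have := sl v bv vm; rewrite ltr_ndivrMl ?subr_lt0 ?lt_neqAle ?vm//.
  by move=> h; lra.
Qed.

(** Apply ln y < y at y = 1 / sqrt x. *)
Lemma norm_xlnx_le (x : R) : x <= 1 -> `|x * ln x| <= 2 * Num.sqrt x.
Proof.
move=> x1; have [x0|x0] := leP x 0.
  by rewrite ln0// mulr0 normr0 mulr_ge0// sqrtr_ge0.
have s0 : 0 < Num.sqrt x by rewrite sqrtr_gt0.
rewrite ler0_norm; last by rewrite mulr_ge0_le0 ?ln_le0// ltW.
have -> : ln x = - (2 * ln (Num.sqrt x)^-1).
  by rewrite lnV ?posrE// -{1}(sqr_sqrtr (ltW x0)) lnXn// mulr2n; ring.
have := ln_sublinear (_ : 0 < (Num.sqrt x)^-1); rewrite invr_gt0 => /(_ s0) h.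
rewrite mulrN opprK mulrCA ler_pM2l// -{1}(sqr_sqrtr (ltW x0)) expr2 -mulrA.
by rewrite ler_piMr ?(ltW s0)// mulrC -ler_pdivlMr// mul1r ltW.
Qed.

(** The convention ln x = 0 for x <= 0 makes this hold on the whole line. *)
Lemma continuous_xlnx : continuous (fun x : R => x * ln x).
Proof.
move=> x; have [x0|x0|->] := ltgtP x 0.
- apply: (@near_cst_continuous _ _ 0).
  apply: filterS (lt_nbhsl x0) => y y0.
  by rewrite ln0 ?mulr0// ltW.
- by apply: cvgM; [exact: cvg_id | exact: continuous_ln].
apply/cvgrPdist_lt => e e0; apply/nbhs_ballP.
exists (Num.min 1 ((e / 2) ^+ 2)) => /=.
  by rewrite lt_min ltr01 exprn_gt0// divr_gt0.
move=> y; rewrite /ball/= sub0r normrN lt_min => /andP[y1 ye].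
rewrite mul0r sub0r normrN.
rewrite (le_lt_trans (norm_xlnx_le _))//;
  first by rewrite ltW// (le_lt_trans (ler_norm y)).
rewrite mulrC -ltr_pdivlMr// -(@gtr0_norm _ (e / 2)) ?divr_gt0// -sqrtr_sqr.
by rewrite ltr_sqrt ?exprn_gt0 ?divr_gt0// (le_lt_trans (ler_norm y)).
Qed.

Lemma box_EVT_max (q : nat) (A : set 'rV[R]_q) (f : 'rV[R]_q -> R) :
  A !=set0 -> closed A -> (forall t r, A t -> `|t ord0 r| <= 1) ->
  continuous f -> exists2 t, A t & forall u, A u -> f u <= f t.
Proof.
move=> A0 clA A1 cf.
have cA : compact A.
  have cbox : compact [set v : 'rV[R]_q | forall i, `[(-1 : R), 1]%classic (v
    ord0 i)].
    by apply: (@rV_compact _ _ (fun=> `[(-1 : R), 1]%classic)) => _;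
      exact: segment_compact.
  apply: (subclosed_compact clA cbox) => t At i /=.
  by rewrite in_itv/= -ler_norml A1.
have [|t /set_mem At tmax] := EVT_max_rV A0 cA (f := f).
  exact: continuous_subspaceT.
by exists t => // u Au; apply/tmax/mem_set.
Qed.

End calculus.

Section power_remainder.
Context (R : realDomainType).

Definition pow_remainder (n : nat) (x y : R) : R :=
  y ^+ n - x ^+ n - n%:R * x ^+ n.-1 * (y - x).

(** The recursion that yields both the sign and the size of the remainder. *)
Lemma pow_remainderS n x y :
  pow_remainder n.+1 x y =
  y * pow_remainder n x y + n%:R * x ^+ n.-1 * (y - x) ^+ 2.
Proof.
rewrite /pow_remainder; case: n => [|n]; first by rewrite !expr0; ring.
by rewrite /= !exprS -!natr1; ring.
Qed.

Lemma pow_remainder_ge0 n x y : 0 <= x -> 0 <= y -> 0 <= pow_remainder n x y.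
Proof.
move=> x0 y0; elim: n => [|n IH]; first by rewrite /pow_remainder subrr !mul0r
  subr0.
by rewrite pow_remainderS addr_ge0// mulr_ge0 ?sqr_ge0// mulr_ge0 ?exprn_ge0.
Qed.

Lemma pow_remainder_le n : exists2 K : R, 0 <= K & forall x y : R,
  `|x| <= 2 -> `|y| <= 2 -> `|pow_remainder n x y| <= K * (y - x) ^+ 2.
Proof.
elim: n => [|n [K K0 IH]].
  exists 0 => // x y _ _.
  by rewrite /pow_remainder subrr !mul0r subr0 normr0.
exists (2 * K + n%:R * 2 ^+ n.-1); first by rewrite addr_ge0 ?mulr_ge0
  ?exprn_ge0.
move=> x y x2 y2; rewrite pow_remainderS (le_trans (ler_normD _ _))// mulrDl.
rewrite lerD//.
  by rewrite normrM -mulrA ler_pM// IH.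
rewrite normrM (ger0_norm (sqr_ge0 _)) ler_wpM2r ?sqr_ge0//.
by rewrite normrM normr_nat ler_wpM2l// normrX lerXn2r// nnegrE.
Qed.

End power_remainder.

Section exponential_remainder.
Context (R : realType).

Lemma expR_remainder (C : R) : exists2 K : R, 0 <= K & forall y : R,
  `|y| <= C -> `|expR y - (1 + y)| <= K * y ^+ 2.
Proof.
(* For y <= 1/2 the inequality exp (- y) >= 1 - y gives the constant 2; for
   larger y both exp y <= exp C and 1 <= 4 y^2 hold. *)
exists (2 + 4 * expR C); first by rewrite addr_ge0// mulr_ge0// expR_ge0.
move=> y; rewrite ler_norml => /andP[_ yC].
rewrite ger0_norm ?subr_ge0 ?expR_ge1Dx//.
have eC := expR_ge0 C; have y2 := sqr_ge0 y.
have [y12|y12] := leP y (1 / 2).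
  have ey : expR y * (1 - y) <= 1.
    rewrite -(mulr1 (expR y)) -mulrA mul1r -[leRHS](expRxMexpNx_1 y).
    by rewrite ler_wpM2l ?expR_ge0// expR_ge1Dx.
  have : expR y - (1 + y) <= 2 * y ^+ 2.
    have : (expR y - (1 + y)) * (1 - y) <= y ^+ 2 by nra.
    have : 0 <= expR y - (1 + y) by rewrite subr_ge0 expR_ge1Dx.
    by nra.
  by have := mulr_ge0 eC y2; lra.
have eyC : expR y <= expR C by rewrite ler_expR.
have : expR C * 1 <= expR C * (4 * y ^+ 2) by rewrite ler_wpM2l//; nra.
lra.
Qed.

Lemma sqr1D_le_expR (v : R) : 0 <= v ->
  (1 + v) ^+ 2 <= expR (2 * v).
Proof.
move=> v0; rewrite (expRM_natl 2) lerXn2r ?nnegrE ?expR_ge0 ?addr_ge0//.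
exact: expR_ge1Dx.
Qed.

End exponential_remainder.

(** * The normal distribution and Stein's equation *)

Section normal_cdf.
Context (R : realType) (sd : R) (sd0 : sd != 0).

Definition normal_cdf (x : R) : R := fine (normal_prob 0 sd `]-oo, x]%classic).

Lemma normal_cdfE x :
  normal_prob 0 sd `]-oo, x]%classic = (normal_cdf x)%:E.
Proof. by rewrite /normal_cdf fineK// fin_num_measure. Qed.

Lemma normal_cdf_ge0 x : 0 <= normal_cdf x.
Proof. by rewrite -lee_fin -normal_cdfE. Qed.

Lemma normal_cdf_le1 x : normal_cdf x <= 1.
Proof. by rewrite -lee_fin -normal_cdfE probability_le1. Qed.

Lemma normal_cdf_nondecreasing : {homo normal_cdf : x y / x <= y}.
Proof.
move=> x y xy; rewrite -lee_fin -!normal_cdfE le_measure ?inE//.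
exact: subset_itvl.
Qed.

Lemma is_derive_normal_cdf (x : R) :
  is_derive x 1 normal_cdf (normal_pdf 0 sd x).
Proof.
have ipdf : lebesgue_measure.-integrable `]-oo, x + 1] (EFin \o normal_pdf 0
  sd).
  apply: (@integrableS _ _ _ lebesgue_measure setT) => //.
  exact: integrable_normal_pdf.
have xx1 : x < x + 1 by rewrite ltrDl.
have [dF F'] := continuous_FTC1 xx1 ipdf (ltNyr _)
  (continuous_normal_pdf sd0 (x := x)).
have cdfE : normal_cdf =
  (fun y => \int[lebesgue_measure]_(t in `]-oo, y]) normal_pdf 0 sd t) by [].
by rewrite cdfE; apply: DeriveDef; [exact: dF | rewrite -derive1E; exact: F'].
Qed.

Lemma is_derive_normal_pdf (x : R) :
  is_derive x 1 (normal_pdf 0 sd) (- x / sd ^+ 2 * normal_pdf 0 sd x).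
Proof.
rewrite normal_pdfE// /normal_fun.
rewrite (_ : (fun _ => _) = normal_peak sd \*: (expR \o (fun y =>
  - (sd ^+ 2 *+ 2)^-1 *: y ^+ 2))); last first.
  by apply/funext => y /=; rewrite subr0 /GRing.scale/=; congr (_ * expR _);
    ring.
apply: is_derive_eq.
rewrite /GRing.scale/= subr0; set e := expR _; set e' := expR _.
have -> : e' = e by rewrite /e /e'; congr expR; ring.
by field.
Qed.

Lemma normal_pdf_gt0 x : 0 < normal_pdf 0 sd x.
Proof. by rewrite normal_pdfE// mulr_gt0 ?normal_peak_gt0// expR_gt0. Qed.

(* The identity as a random variable, whose distribution function is the one
   under study. *)
Let idR : measurableTypeR R -> R := idfun.

#[local] HB.instance Definition _ :=
  @isMeasurableFun.Build _ _ _ _ idR (@measurable_id _ _ setT).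

Lemma cvg_normal_cdfNy : normal_cdf x @[x --> -oo] --> (0 : R).
Proof.
have := @cvg_cdfNy0 _ _ _ (normal_prob 0 sd) (idR : {RV (normal_prob 0 sd :
  probability _ _) >-> R}).
by move=> /fine_cvgP[].
Qed.

Lemma cvg_normal_cdfy : normal_cdf x @[x --> +oo] --> (1 : R).
Proof.
have := @cvg_cdfy1 _ _ _ (normal_prob 0 sd) (idR : {RV (normal_prob 0 sd :
  probability _ _) >-> R}).
by move=> /fine_cvgP[].
Qed.

Lemma normal_pdf_le x y : `|x| <= `|y| -> normal_pdf 0 sd y <=
  normal_pdf 0 sd x.
Proof.
move=> xy; rewrite normal_pdfE// ler_pM2l ?normal_peak_gt0// ler_expR !subr0.
rewrite ler_pM2r ?invr_gt0 ?mulrn_wgt0 ?exprn_even_gt0//= lerN2.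
by rewrite -(real_normK (num_real x)) -(real_normK (num_real y)) lerXn2r//
  nnegrE.
Qed.

(** Below -1 the function sd^2 * pdf - cdf is nondecreasing, because its
derivative is (- x - 1) * pdf, and its limit at -oo is nonnegative; hence it
is nonnegative. *)
Lemma mills_left :
  exists C : R, forall x : R, x <= 0 -> normal_cdf x <= C * normal_pdf 0 sd x.
Proof.
have pN1 := normal_pdf_gt0 (-1).
exists (sd ^+ 2 + (normal_pdf 0 sd (-1))^-1) => x x0.
have px := normal_pdf_gt0 x.
have [x1|x1] := leP x (-1); last first.
  rewrite (le_trans (normal_cdf_le1 x))// mulrDl.
  have : normal_pdf 0 sd (-1) <= normal_pdf 0 sd x.
    by apply: normal_pdf_le; rewrite normrN1 ler_norml; lra.
  rewrite -[leLHS]mulr1 -ler_pdivlMl// => /le_trans; apply.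
  by rewrite lerDr mulr_ge0 ?sqr_ge0// ltW.
pose K u := sd ^+ 2 * normal_pdf 0 sd u - normal_cdf u.
have dK (u : R) : is_derive u 1 K ((- u - 1) * normal_pdf 0 sd u).
  have := is_derive_normal_pdf u; have := is_derive_normal_cdf u => ? ?.
  rewrite /K (_ : (fun _ => _) = sd ^+ 2 \*: normal_pdf 0 sd - normal_cdf)//.
  by apply: is_derive_eq; rewrite /GRing.scale/=; field.
have monoK (u : R) : u <= x -> K u <= K x.
  move=> ux; have [v /andP[uv vx]] := mvt_segment ux (fun w _ => dK w).
  rewrite -subr_ge0 => ->.
  rewrite mulr_ge0 ?subr_ge0// mulr_ge0 ?(ltW (normal_pdf_gt0 _))//.
  lra.
suff : 0 <= K x.
  rewrite /K subr_ge0 => /le_trans; apply.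
  by rewrite mulrDl lerDl mulr_ge0 ?invr_ge0 ?ltW.
rewrite leNgt; apply/negP => Kx.
have /cvgrPdist_lt/(_ (- K x)) := cvg_normal_cdfNy.
rewrite oppr_gt0 => /(_ Kx)[M [Mreal HM]].
have [u uM ux] : exists2 u, u < M & u <= x.
  exists (Num.min (M - 1) x); rewrite ?ge_min ?lexx ?orbT//.
  by rewrite gt_min; apply/orP; left; lra.
have := HM _ uM; rewrite sub0r normrN ger0_norm ?normal_cdf_ge0// => h.
have := monoK _ ux; rewrite leNgt => /negP; apply.
rewrite (@lt_le_trans _ _ (- normal_cdf u))//; first by lra.
by rewrite /K lerDr mulr_ge0 ?sqr_ge0// ltW// normal_pdf_gt0.
Qed.

(** The mirror image of the preceding bound. *)
Lemma mills_right : exists C : R,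
  forall x : R, 0 <= x -> 1 - normal_cdf x <= C * normal_pdf 0 sd x.
Proof.
have p1 := normal_pdf_gt0 1.
exists (sd ^+ 2 + (normal_pdf 0 sd 1)^-1) => x x0.
have px := normal_pdf_gt0 x.
have [x1|x1] := leP 1 x; last first.
  rewrite (@le_trans _ _ 1)//; first by rewrite gerBl normal_cdf_ge0.
  rewrite mulrDl.
  have : normal_pdf 0 sd 1 <= normal_pdf 0 sd x.
    by apply: normal_pdf_le; rewrite normr1 ler_norml; lra.
  rewrite -[leLHS]mulr1 -ler_pdivlMl// => /le_trans; apply.
  by rewrite lerDr mulr_ge0 ?sqr_ge0// ltW.
pose K u := sd ^+ 2 * normal_pdf 0 sd u + normal_cdf u.
have dK (u : R) : is_derive u 1 K ((1 - u) * normal_pdf 0 sd u).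
  have := is_derive_normal_pdf u; have := is_derive_normal_cdf u => ? ?.
  rewrite /K (_ : (fun _ => _) = sd ^+ 2 \*: normal_pdf 0 sd + normal_cdf)//.
  by apply: is_derive_eq; rewrite /GRing.scale/=; field.
have monoK (u : R) : x <= u -> K u <= K x.
  move=> ux; have [v /andP[uv vx]] := mvt_segment ux (fun w _ => dK w).
  rewrite -subr_le0 => ->.
  rewrite mulr_le0_ge0 ?subr_ge0// mulr_le0_ge0 ?(ltW (normal_pdf_gt0 _))//.
  lra.
suff : 1 <= K x.
  rewrite /K -lerBlDr => /le_trans; apply.
  by rewrite mulrDl lerDl mulr_ge0 ?invr_ge0 ?ltW.
rewrite leNgt; apply/negP => Kx.
have /cvgrPdist_lt/(_ (1 - K x)) := cvg_normal_cdfy.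
rewrite subr_gt0 => /(_ Kx)[M [Mreal HM]].
have [u uM ux] : exists2 u, M < u & x <= u.
  exists (Num.max (M + 1) x); rewrite ?le_max ?lexx ?orbT//.
  by rewrite lt_max; apply/orP; left; lra.
have := HM _ uM; rewrite ger0_norm ?subr_ge0 ?normal_cdf_le1// => h.
have := monoK _ ux; rewrite leNgt => /negP; apply.
rewrite (@lt_le_trans _ _ (normal_cdf u))//; first by lra.
by rewrite /K lerDr mulr_ge0 ?sqr_ge0// ltW// normal_pdf_gt0.
Qed.

(** The bounded solution of the Stein equation
  sd^2 * g' - u * g = sd^2 * (1_{u <= y} - cdf y)
for the half-line with end point y. *)
Definition stein_solution (y u : R) : R :=
  (if u <= y then normal_cdf u * (1 - normal_cdf y)
   else normal_cdf y * (1 - normal_cdf u)) / normal_pdf 0 sd u.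

Let is_derive_ratio (f : R -> R) (k u : R) :
  is_derive u 1 f (k * normal_pdf 0 sd u) ->
  is_derive u 1 (fun v => f v / normal_pdf 0 sd v)
    (u / sd ^+ 2 * (f u / normal_pdf 0 sd u) + k).
Proof.
move=> df; have dn := is_derive_normal_pdf u.
have n0 : normal_pdf 0 sd u != 0 by rewrite gt_eqF// normal_pdf_gt0.
rewrite (_ : (fun _ => _) = f * (fun v => (normal_pdf 0 sd v)^-1))//.
have dV := is_deriveV n0 dn.
by apply: is_derive_eq; rewrite /GRing.scale/=; field; rewrite n0.
Qed.

(** Each of the two branches is dominated by the tail on the side of u that
Mills' estimate controls. *)
Lemma stein_solution_bounded :
  exists C : R, forall y u, `|stein_solution y u| <= C.
Proof.
have [C1 HC1] := mills_left; have [C2 HC2] := mills_right.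
exists (Num.max C1 C2) => y u.
have nu := normal_pdf_gt0 u.
rewrite /stein_solution ger0_norm; last first.
  rewrite divr_ge0 ?(ltW nu)//; case: ifP => _;
  by rewrite mulr_ge0 ?subr_ge0 ?normal_cdf_ge0 ?normal_cdf_le1.
rewrite ler_pdivrMr//.
have Fu := normal_cdf_ge0 u; have Fu1 := normal_cdf_le1 u.
have Fy := normal_cdf_ge0 y; have Fy1 := normal_cdf_le1 y.
have [u0|u0] := leP u 0.
  apply: (@le_trans _ _ (C1 * normal_pdf 0 sd u)); last first.
    by rewrite ler_pM2r// le_max lexx.
  apply: le_trans _ (HC1 _ u0); have [uy|uy] := leP u y;
    first by rewrite ler_piMr// gerBl.
  have := normal_cdf_nondecreasing (ltW uy); nra.
apply: (@le_trans _ _ (C2 * normal_pdf 0 sd u)); last first.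
  by rewrite ler_pM2r// le_max lexx orbT.
apply: le_trans _ (HC2 _ (ltW u0)).
have : normal_cdf y <= 1 by [].
have [uy|uy] := leP u y; first by have := normal_cdf_nondecreasing uy; nra.
by nra.
Qed.

(** One step of a function that solves a first-order linear equation: the
equation itself turns a bound on G into bounds on its first two derivatives. *)
Let ode_step (G : R -> R) (C k u e : R) : `|k| <= 1 -> 0 <= e <= 1 ->
  (forall v : R, u - e <= v <= u ->
     is_derive v 1 G (v / sd ^+ 2 * G v + k) /\ `|G v| <= C) ->
  `|G u - G (u - e) - e * (u / sd ^+ 2 * G u + k)| <=
    (C + C / sd ^+ 2 + 1) / sd ^+ 2 * e ^+ 2 * (1 + `|u|) ^+ 2.
Proof.
move=> k1 /andP[e0 e1] HG.
have s0 : 0 < sd ^+ 2 by rewrite exprn_even_gt0.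
have C0 : 0 <= C by have [_] := HG u (ltac:(lra)); exact: le_trans.
have ueu : u - e <= u by rewrite gerBl.
have [c /andP[uc cu]] := mvt_segment ueu (fun v hv => (HG v hv).1).
move=> ->; rewrite (_ : u - (u - e) = e); last by ring.
have [d /andP[cd du] Gd] := mvt_segment cu
  (fun v hv => (HG v (ltac:(by move: hv => /andP[? ?]; apply/andP; lra))).1).
have [_ Gc] := HG c (ltac:(by apply/andP)).
have [_ Gdb] := HG d (ltac:(by apply/andP; lra)).
have dG : `|d / sd ^+ 2 * G d + k| <= (1 + `|u|) * (C / sd ^+ 2) + 1.
  rewrite (le_trans (ler_normD _ _))// lerD//.
  rewrite mulrAC -mulrA !normrM ler_pM ?mulr_ge0//.
    rewrite (_ : d = (d - u) + u); last by ring.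
    rewrite (le_trans (ler_normD _ _))// lerD2r ler_norml; lra.
  by rewrite normfV (gtr0_norm s0) ler_pM2r ?invr_gt0.
have -> : (c / sd ^+ 2 * G c + k) * e - e * (u / sd ^+ 2 * G u + k) =
  e / sd ^+ 2 * ((c - u) * G c - u * (G u - G c)) by ring.
rewrite normrM ger0_norm ?divr_ge0 ?(ltW s0)//.
rewrite (_ : _ / _ * _ * _ = e / sd ^+ 2 *
    (e * ((C + C / sd ^+ 2 + 1) * (1 + `|u|) ^+ 2))); last by ring.
rewrite ler_wpM2l ?divr_ge0 ?(ltW s0)// Gd.
rewrite (le_trans (ler_normB _ _))// !normrM.
have uc0 : `|u - c| <= e by rewrite ler_norml; lra.
have h1 : `|c - u| * `|G c| <= e * C by rewrite ler_pM// distrC.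
have h2 : `|u| * (`|d / sd ^+ 2 * G d + k| * `|u - c|) <=
   `|u| * (((1 + `|u|) * (C / sd ^+ 2) + 1) * e) by rewrite ler_wpM2l// ler_pM.
rewrite (le_trans (lerD h1 h2))//.
have : 0 <= C / sd ^+ 2 by rewrite divr_ge0 ?(ltW s0).
set D := C / sd ^+ 2; move=> D0; have u0 := normr_ge0 u.
rewrite (_ : _ + _ = e * (C + `|u| * ((1 + `|u|) * D + 1))); last by ring.
rewrite ler_wpM2l//.
have := mulr_ge0 C0 u0; have := mulr_ge0 D0 u0; have := mulr_ge0 u0 u0.
have := mulr_ge0 C0 (mulr_ge0 u0 u0); have := mulr_ge0 D0 (mulr_ge0 u0 u0).
set v := `|u|; move=> *; nra.
Qed.

(** The Stein solution has a corner at y, so its one-step difference quotient is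
close to its derivative only if the step does not jump over y. *)
Lemma stein_solution_step : exists2 C : R, 0 <= C & forall y u e : R,
  0 <= e <= 1 -> u <= y \/ y <= u - e ->
  `|stein_solution y u - stein_solution y (u - e)
    - e * (u / sd ^+ 2 * stein_solution y u + ((u <=
      y)%R%:R - normal_cdf y))| <=
    C * e ^+ 2 * (1 + `|u|) ^+ 2.
Proof.
have [C HC] := stein_solution_bounded.
have s0 : 0 < sd ^+ 2 by rewrite exprn_even_gt0.
have C0 : 0 <= C by exact: le_trans (HC 0 0).
exists ((C + C / sd ^+ 2 + 1) / sd ^+ 2).
  by rewrite divr_ge0 ?addr_ge0 ?divr_ge0 ?(ltW s0).
move=> y u e e01 yu.
have Fy := normal_cdf_ge0 y; have Fy1 := normal_cdf_le1 y.
pose gl v := normal_cdf v * (1 - normal_cdf y) / normal_pdf 0 sd v.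
pose gr v := normal_cdf y * (1 - normal_cdf v) / normal_pdf 0 sd v.
have dgl (v : R) : is_derive v 1 gl (v / sd ^+ 2 * gl v + (1 - normal_cdf y)).
  apply: (@is_derive_ratio (fun v => normal_cdf v * (1 - normal_cdf y))).
  have dn := is_derive_normal_cdf v.
  rewrite (_ : (fun _ => _) = (1 - normal_cdf y) \*: normal_cdf).
    exact: is_derive_eq.
  by apply/funext => z; rewrite mulrC.
have dgr (v : R) : is_derive v 1 gr (v / sd ^+ 2 * gr v + (- normal_cdf y)).
  apply: (@is_derive_ratio (fun v => normal_cdf y * (1 - normal_cdf v))).
  have dn := is_derive_normal_cdf v.
  rewrite (_ : (fun _ => _) = normal_cdf y \*: (cst 1 - normal_cdf))//.
  by apply: is_derive_eq; rewrite /GRing.scale/=; ring.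
have El v : v <= y -> stein_solution y v = gl v.
  by rewrite /stein_solution => ->.
have Er v : y <= v -> stein_solution y v = gr v.
  rewrite le_eqVlt => /orP[/eqP <-|yv].
    by rewrite /stein_solution lexx.
  by rewrite /stein_solution leNgt yv.
have /andP[e0 e1] := e01.
case: yu => [uy|yue].
  rewrite !El; [rewrite uy mulr1n|lra..].
  apply: ode_step => //; first by rewrite ler_norml; apply/andP; split; lra.
  move=> v /andP[? ?]; split; first exact: dgl.
  by rewrite -El ?HC//; lra.
have [uy|uy] := leP u y.
  have {uy} ? : u = y by lra.
  have e00 : e = 0 by lra.
  by rewrite e00 subr0 subrr mul0r subr0 normr0 expr0n/= mulr0 mul0r.
rewrite !Er; [|lra..]; rewrite sub0r.
apply: ode_step => //; first by rewrite ler_norml; apply/andP; split; lra.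
move=> v /andP[? ?]; split; first exact: dgr.
by rewrite -Er ?HC//; lra.
Qed.

End normal_cdf.

(** * Means under the Gibbs measure *)

Section gibbs_mean_theory.
Context (R : realType) (p q : nat) (c : 'I_q) (beta h : R) (N : nat).
Implicit Types F G : config q N -> R.

Definition gibbs_mean (F : config q N -> R) : R :=
  \sum_(X : config q N) gibbs p c beta h X * F X.

Lemma gibbs_weight_gt0 (X : config q N) : 0 < gibbs_weight p c beta h X.
Proof. exact: expR_gt0. Qed.

Lemma partition_gt0 : 0 < \sum_(X : config q N) gibbs_weight p c beta h X.
Proof.
rewrite (bigD1 [ffun=> c])//= ltr_pwDl ?gibbs_weight_gt0// sumr_ge0// => Y _.
exact/ltW/gibbs_weight_gt0.
Qed.

Local Notation E := gibbs_mean.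

Lemma gibbs_ge0 (X : config q N) : 0 <= gibbs p c beta h X.
Proof. by rewrite divr_ge0 ?ltW ?gibbs_weight_gt0 ?partition_gt0. Qed.

Lemma gibbs_mean_cst (k : R) : E (fun _ : config q N => k) = k.
Proof.
rewrite /gibbs_mean -mulr_suml /gibbs -mulr_suml divff ?mul1r//.
by rewrite gt_eqF// partition_gt0.
Qed.

Lemma gibbs_meanD F G : E (fun X => F X + G X) = E F + E G.
Proof. by rewrite /gibbs_mean -big_split; apply: eq_bigr => X _;
  rewrite mulrDr. Qed.

Lemma gibbs_meanB F G : E (fun X => F X - G X) = E F - E G.
Proof. by rewrite /gibbs_mean -sumrB; apply: eq_bigr => X _;
  rewrite mulrBr. Qed.

Lemma gibbs_meanZ (k : R) F : E (fun X => k * F X) = k * E F.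
Proof. by rewrite /gibbs_mean mulr_sumr; apply: eq_bigr => X _;
  rewrite mulrCA. Qed.

Lemma gibbs_mean_le F G : (forall X, F X <= G X) -> E F <= E G.
Proof. by move=> FG; apply: ler_sum => X _; rewrite ler_wpM2l ?gibbs_ge0. Qed.

Lemma gibbs_mean_norm F : `|E F| <= E (fun X => `|F X|).
Proof.
apply: le_trans (ler_norm_sum _ _ _) _; apply: ler_sum => X _.
by rewrite normrM ger0_norm ?gibbs_ge0.
Qed.

Lemma gibbs_mean_ge0 F : (forall X, 0 <= F X) -> 0 <= E F.
Proof. by move=> F0; apply: sumr_ge0 => X _; rewrite mulr_ge0 ?gibbs_ge0. Qed.

End gibbs_mean_theory.

Lemma color_freqE (R : realType) (q N : nat) (X : config q N) (r : 'I_q) :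
  color_freq R X r = (\sum_(i < N) (X i == r)%:R) / N%:R.
Proof.
rewrite /color_freq cardsE -sum1_card natr_sum; congr (_ / _).
by rewrite big_mkcond; apply: eq_bigr => i _;
  rewrite [in LHS]unfold_in/= -[eqn _ _]/(X i == r); case: (X i == r).
Qed.

(** * The maximum likelihood estimator *)

Section exponential_sum.
Context (R : realType) (T : finType) (a k : T -> R).

Definition exp_sum (x : R) : R := \sum_i a i * expR (x * k i).

(** The derivative of the preceding function. *)
Definition exp_sum' (x : R) : R := \sum_i a i * k i * expR (x * k i).

Lemma continuous_exp_sum' : continuous exp_sum'.
Proof.
move=> x; apply: cvg_sumr => i _; apply: cvgMl_tmp.
apply: continuous_comp; last exact: continuous_expR.
by apply: cvgMr_tmp; exact: cvg_id.
Qed.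

Hypothesis a_gt0 : forall i, 0 < a i.
Hypothesis k_neq0 : exists i, k i != 0.

(** Strict convexity, from 1 + x < exp x; it replaces differentiation in what
follows. *)
Lemma exp_sum_tangent (x y : R) : x != y ->
  exp_sum x + exp_sum' x * (y - x) < exp_sum y.
Proof.
move=> xy; rewrite /exp_sum /exp_sum' mulr_suml -big_split/= -subr_gt0 -sumrB.
have E i : a i * expR (y * k i) - (a i * expR (x * k i)
    + a i * k i * expR (x * k i) * (y - x)) =
    a i * expR (x * k i) * (expR ((y - x) * k i) - (1 + (y - x) * k i)).
  by rewrite (_ : y * k i = x * k i + (y - x) * k i) ?expRD; ring.
have aepos i : 0 < a i * expR (x * k i) by rewrite mulr_gt0 ?expR_gt0.
have [i ki] := k_neq0.
rewrite (bigD1 i)//=; apply: ltr_pwDl; last first.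
  by apply: sumr_ge0 => j _; rewrite E pmulr_rge0// subr_ge0 expR_ge1Dx.
by rewrite E pmulr_rgt0// subr_gt0 expR_gt1Dx// mulf_neq0// subr_eq0 eq_sym.
Qed.

Lemma exp_sum'_increasing (x y : R) : x < y -> exp_sum' x < exp_sum' y.
Proof.
move=> xy; have xNy : x != y by rewrite lt_eqF.
have := exp_sum_tangent xNy; rewrite eq_sym in xNy.
have := exp_sum_tangent xNy => h1 h2.
have : 0 < (exp_sum' y - exp_sum' x) * (y - x) by lra.
by rewrite pmulr_lgt0 subr_gt0.
Qed.
End exponential_sum.

Section argmax_of_reciprocal.
Context (R : realType) (T : finType) (a k : T -> R).
Hypothesis a_gt0 : forall i, 0 < a i.
Hypothesis k_neq0 : exists i, k i != 0.
Hypothesis k_eq0 : exists i, k i = 0.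

(** The condition on an estimate for an arbitrary likelihood L. *)
Definition is_argmax (L : R -> R) (e : \bar R) : Prop :=
  let is_max := fun b : R => forall x : R, L x <= L b in
  match e with
  | b%:E => is_max b
  | +oo%E => (~ exists b, is_max b) /\ L x @[x --> +oo] --> sup (range L)
  | -oo%E => (~ exists b, is_max b) /\ L x @[x --> -oo] --> sup (range L)
  end.

Let L (x : R) := (exp_sum a k x)^-1.

Let D_gt0 (x : R) : 0 < exp_sum a k x.
Proof.
have [i _] := k_neq0; rewrite /exp_sum (bigD1 i)//=.
rewrite ltr_pwDl ?mulr_gt0 ?expR_gt0// sumr_ge0// => j _.
by rewrite mulr_ge0 ?expR_ge0// ltW.
Qed.

Let L_lt (x y : R) : exp_sum a k y < exp_sum a k x -> L x < L y.
Proof. by move=> yx; rewrite /L ltf_pV2 ?posrE. Qed.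

Let L_ub : has_ubound (range L).
Proof.
have [i ki] := k_eq0; exists (a i)^-1 => _ [x _ <-].
rewrite lef_pV2 ?posrE// /exp_sum (bigD1 i)//= ki mulr0 expR0 mulr1 lerDl.
by rewrite sumr_ge0// => j _; rewrite mulr_ge0 ?expR_ge0// ltW.
Qed.

Let L_critical (b : R) : exp_sum' a k b =
  0 -> forall x : R, x != b -> L x < L b.
Proof.
move=> b0 x xb; apply: L_lt.
have bx : b != x by rewrite eq_sym.
by have := exp_sum_tangent a_gt0 k_neq0 bx; rewrite b0 mul0r addr0.
Qed.

(** By the intermediate value theorem a derivative without a zero has constant
sign. *)
Let D'_sign : [\/ exists b, exp_sum' a k b = 0, forall x, 0 < exp_sum' a k x |
  forall x, exp_sum' a k x < 0].
Proof.
have [b0|Nb] := pselect (exists b, exp_sum' a k b = 0); first exact: Or31.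
have IVT_D' (x y : R) : exp_sum' a k x <= 0 -> 0 <= exp_sum' a k y -> False.
  move=> x0 y0; apply: Nb.
  have xy : x <= y.
    rewrite leNgt; apply/negP => /(exp_sum'_increasing a_gt0 k_neq0).
    by apply/negP; rewrite -leNgt (le_trans x0).
  have [||b _ b0] := @IVT R (exp_sum' a k) x y 0 xy.
  - exact/continuous_subspaceT/continuous_exp_sum'.
  - by rewrite ge_min le_max x0 y0 orbT.
  by exists b.
have [x0|x0] := leP (exp_sum' a k 0) 0.
- by apply: Or33 => x; rewrite ltNge; apply/negP; exact: (IVT_D' 0 x x0).
- apply: Or32 => x; rewrite ltNge; apply/negP => Dx.
  exact: (IVT_D' x 0 Dx (ltW x0)).
Qed.

Let L_decr : (forall x, 0 < exp_sum' a k x) -> forall x y, x < y -> L y < L x.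
Proof.
move=> D'0 x y xy; apply: L_lt; have xNy : x != y by rewrite lt_eqF.
apply: lt_trans (exp_sum_tangent a_gt0 k_neq0 xNy).
by rewrite ltrDl mulr_gt0// subr_gt0.
Qed.

Let L_incr : (forall x, exp_sum' a k x < 0) -> forall x y, x < y -> L x < L y.
Proof.
move=> D'0 x y xy; apply: L_lt; have xNy : y != x by rewrite gt_eqF.
apply: lt_trans (exp_sum_tangent a_gt0 k_neq0 xNy).
by rewrite ltrDl nmulr_rgt0// subr_lt0.
Qed.

(** If the derivative has no zero, the likelihood is monotone and its supremum
is its limit at one end. *)
Lemma is_argmax_ex : exists e, is_argmax L e.
Proof.
rewrite /is_argmax/=; have [[b b0]|D'0|D'0] := D'_sign.
- exists b%:E; rewrite /is_argmax/= => x; have [->//|xb] := eqVneq x b.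
  exact/ltW/L_critical.
- exists -oo%E; rewrite /is_argmax/=; split.
    move=> [b]; have b1 : b - 1 < b by rewrite gtrBl.
    by move=> /(_ (b - 1)); rewrite leNgt L_decr.
  rewrite cvgNy_compNP.
  have -> : range L = range (L \o -%R).
    apply/seteqP; split => _ [x _ <-]; last by exists (- x).
    by exists (- x) => //=; rewrite opprK.
  apply: nondecreasing_cvgr.
    move=> x y; rewrite le_eqVlt => /orP[/eqP->//|xy] /=.
    by rewrite ltW// L_decr// ltrN2.
  by have [M HM] := L_ub; exists M => _ [x _ <-] /=; apply: HM; exists (- x).
- exists +oo%E; rewrite /is_argmax/=; split.
    move=> [b]; have b1 : b < b + 1 by rewrite ltrDl.
    by move=> /(_ (b + 1)); rewrite leNgt L_incr.
  apply: nondecreasing_cvgr => // x y; rewrite le_eqVlt => /orP[/eqP->//|xy].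
  by rewrite ltW// L_incr.
Qed.

Let L_le_sup x : L x <= sup (range L).
Proof. by apply: ub_le_sup => //; exists x. Qed.

(** The derivative of the exponential sum is strictly increasing, so its sign at
x tells on which side of x its zero lies. Without a zero, its constant sign
tells at which end the likelihood approaches its supremum. *)
Lemma is_argmax_le e (x : R) : is_argmax L e ->
  (e <= x%:E)%E = (0 <= exp_sum' a k x).
Proof.
rewrite /is_argmax/=; have [[b b0]|D'0|D'0] := D'_sign.
- case: e => [c Lc|[] []|[] []]; [|by exists b => x'; have [->//|xb] :=
    eqVneq x' b; exact/ltW/L_critical..].
  have -> : c = b.
    apply/eqP/negPn/negP => cb.
    by have := Lc b; rewrite leNgt L_critical.
  rewrite lee_fin; have [bx|xb|<-] := ltgtP b x.
  + by rewrite ltW// -b0 exp_sum'_increasing.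
  + by apply/esym/negbTE; rewrite -ltNge -b0 exp_sum'_increasing.
  + by rewrite b0 lexx.
- rewrite (ltW (D'0 x)); case: e => [c Lc|[_ Ly]|_]; last by rewrite leNye.
  + have c1 : c - 1 < c by rewrite gtrBl.
    by have := Lc (c - 1); rewrite leNgt L_decr.
  + have : sup (range L) <= L 1.
      apply: (cvgr_to_le Ly).
      by apply: filterS (nbhs_pinfty_gt (num_real 1)) => y y1; exact/ltW/L_decr.
    by rewrite leNgt (lt_le_trans (L_decr D'0 ltr01))// L_le_sup.
- have -> : (0 <= exp_sum' a k x) = false by rewrite leNgt D'0.
  case: e => [c Lc|//|[_ LNy]].
  + have c1 : c < c + 1 by rewrite ltrDl.
    by have := Lc (c + 1); rewrite leNgt L_incr.
  + have : sup (range L) <= L 0.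
      apply: (cvgr_to_le LNy).
      by apply: filterS (nbhs_ninfty_lt (num_real 0)) => y y0; exact/ltW/L_incr.
    by rewrite leNgt (lt_le_trans (L_incr D'0 ltr01))// L_le_sup.
Qed.
End argmax_of_reciprocal.

Section mle.
Context (R : realType) (p q : nat) (c : 'I_q) (beta : R) (N : nat).
Hypotheses (q_ge2 : (2 <= q)%N) (N_gt0 : (0 < N)%N).

Implicit Types X Y : config q N.

Let a X Y := gibbs_weight p c beta 0 Y / gibbs_weight p c beta 0 X.
Let k X Y := N%:R * (color_freq R Y c - color_freq R X c).

Let gibbs_weightE (h : R) X :
  gibbs_weight p c beta h X =
  gibbs_weight p c beta 0 X * expR (h * (N%:R * color_freq R X c)).
Proof. by rewrite /gibbs_weight -expRD; congr expR; ring. Qed.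

Let weight_ratio (h : R) X Y :
  gibbs_weight p c beta h Y / gibbs_weight p c beta h X =
  a X Y * expR (h * k X Y).
Proof.
rewrite !(gibbs_weightE h) /a /k.
rewrite (_ : h * (N%:R * (color_freq R Y c - color_freq R X c)) =
  h * (N%:R * color_freq R Y c) - h * (N%:R * color_freq R X c)); last by ring.
by rewrite expRB invfM; ring.
Qed.

Let gibbs_exp_sum X (h : R) : gibbs p c beta h X = (exp_sum (a X) (k X) h)^-1.
Proof.
rewrite /gibbs -invf_div; congr (_^-1); rewrite mulr_suml;
  apply: eq_bigr => Y _.
exact: weight_ratio.
Qed.

(* This makes the exponential sum non-constant; it needs two colours and one
   site. *)
Let freq_distinct X : exists Y, color_freq R Y c != color_freq R X c.
Proof.
have [c' c'c] : exists c' : 'I_q, c' != c.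
  case: q q_ge2 c => [//|[//|n]] _ d.
  by have [d0|d0] := eqVneq d ord0; [exists ord_max; rewrite d0 | exists ord0;
    rewrite eq_sym].
have N0 : N%:R != 0 :> R by rewrite pnatr_eq0 -lt0n.
have full : color_freq R ([ffun=> c] : config q N) c = 1 :> R.
  rewrite color_freqE (eq_bigr (fun=> 1)) ?sumr_const ?card_ord ?divff// => i _.
  by rewrite ffunE eqxx.
have empty : color_freq R ([ffun=> c'] : config q N) c = 0 :> R.
  by rewrite color_freqE big1 ?mul0r// => i _; rewrite ffunE (negbTE c'c).
have [X1|X1] := eqVneq (color_freq R X c) 1.
  by exists [ffun=> c']; rewrite X1 empty eq_sym oner_eq0.
by exists [ffun=> c]; rewrite full eq_sym.
Qed.

(** The likelihood is the reciprocal of a strictly convex exponential sum whose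
derivative has the sign of the difference of the two sides on the right. *)
Lemma mle_le X (x : R) :
  (mle p c beta X <= x%:E)%E =
  (color_freq R X c <= gibbs_mean p c beta x (fun Y : config q N =>
    color_freq R Y c)).
Proof.
have Nge0 : 0 < N%:R :> R by rewrite ltr0n.
have a0 Y : 0 < a X Y by rewrite divr_gt0 ?gibbs_weight_gt0.
have k0 : exists Y, k X Y = 0 by exists X; rewrite /k subrr mulr0.
have kN0 : exists Y, k X Y != 0.
  have [Y XY] := freq_distinct X.
  by exists Y; rewrite /k mulf_neq0 ?subr_eq0// gt_eqF.
have LE : (fun h => gibbs p c beta h X) = (fun h => (exp_sum (a X) (k X) h)^-1).
  by apply/funext => h; exact: gibbs_exp_sum.
have mleP : is_argmax (fun h => gibbs p c beta h X) (mle p c beta X).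
  apply: (@xgetPex _ _ [set e | is_mle p c beta X e]).
  have [e eP] := is_argmax_ex a0 kN0 k0; exists e.
  by rewrite -LE in eP.
rewrite LE in mleP; rewrite (is_argmax_le a0 kN0 k0 x mleP).
have Z0 := partition_gt0 p c beta x N.
have -> : exp_sum' (a X) (k X) x = N%:R / gibbs p c beta x X *
    (gibbs_mean p c beta x (fun Y : config q N =>
      color_freq R Y c) - color_freq R X c).
  rewrite /exp_sum' /gibbs_mean.
  have -> : color_freq R X c = \sum_(Y : config q N) gibbs p c beta x Y *
    color_freq R X c.
    rewrite -mulr_suml /gibbs -mulr_suml divff ?mul1r//.
    exact: lt0r_neq0.
  rewrite -sumrB mulr_sumr; apply: eq_bigr => Y _.
  rewrite mulrAC -weight_ratio /k /gibbs.
  by field; rewrite !gt_eqF ?gibbs_weight_gt0.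
by rewrite pmulr_rge0 ?subr_ge0// divr_gt0// divr_gt0 ?gibbs_weight_gt0.
Qed.
End mle.

(** * The free energy near its maximizer *)

Section quadratic_bound.
Context (R : realType) (q : nat).
Implicit Types (t m : 'rV[R]_q) (d : 'I_q -> R).

Lemma continuous_sum_coord (f : 'I_q -> R -> R) :
  (forall r, continuous (f r)) ->
  continuous (fun t : 'rV[R]_q => \sum_(r < q) f r (t ord0 r)).
Proof.
move=> cf t; apply: (@cvg_sumr R _ _ (nbhs t)) => r _.
apply: continuous_comp; last exact: cf.
exact: coord_continuous.
Qed.

Lemma closed_sum_coord (f : 'I_q -> R -> R) (D : set R) :
  (forall r, continuous (f r)) -> closed D ->
  closed [set t : 'rV[R]_q | D (\sum_(r < q) f r (t ord0 r))].
Proof.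
move=> cf; apply: preimage_closed => t _; exact: continuous_sum_coord.
Qed.

(** Homogeneity and compactness of the unit sphere. *)
Lemma neg_def_bound d :
  (forall t, \sum_(r < q) t ord0 r = 0 -> t != 0 -> \sum_(r < q) d r * t ord0 r
    ^+ 2 < 0) ->
  exists2 k : R, 0 < k & forall t, \sum_(r < q) t ord0 r = 0 ->
    \sum_(r < q) d r * t ord0 r ^+ 2 <= - k * \sum_(r < q) t ord0 r ^+ 2.
Proof.
move=> dneg.
pose S := [set t : 'rV[R]_q | \sum_(r < q) t ord0 r =
  0 /\ \sum_(r < q) t ord0 r ^+ 2 = 1].
have sq0 t : 0 <= \sum_(r < q) t ord0 r ^+ 2 by apply: sumr_ge0 => r _;
  exact: sqr_ge0.
have normalize t : \sum_(r < q) t ord0 r =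
  0 -> 0 < \sum_(r < q) t ord0 r ^+ 2 ->
    S ((Num.sqrt (\sum_(r < q) t ord0 r ^+ 2))^-1 *: t).
  move=> t0 tt0; split.
    by under eq_bigr do rewrite mxE; rewrite -mulr_sumr t0 mulr0.
  under eq_bigr do rewrite mxE exprMn.
  by rewrite -mulr_sumr exprVn sqr_sqrtr// mulVf// gt_eqF.
have [[t0 St0]|S0] := pselect (S !=set0); last first.
  exists 1 => // t t0; suff -> : t = 0.
    by rewrite !big1 ?mulr0// => r _; rewrite mxE expr0n/= ?mulr0.
  apply/rowP => r; rewrite mxE; apply/eqP/negPn/negP => tr.
  apply: S0; eexists; apply: normalize t0 _.
  rewrite (bigD1 r)//= ltr_pwDl ?exprn_even_gt0//.
  by apply: sumr_ge0 => ? _; exact: sqr_ge0.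
have clS : closed S.
  rewrite (_ : S = [set t : 'rV[R]_q | [set 0] (\sum_(r < q) t ord0 r)] `&`
    [set t : 'rV[R]_q | [set 1] (\sum_(r < q) t ord0 r ^+ 2)])//.
  apply: closedI.
    apply: (@closed_sum_coord (fun=> id)); last exact: closed_eq.
    by move=> r x; exact: cvg_id.
  apply: (@closed_sum_coord (fun=> fun x => x ^+ 2)); last exact: closed_eq.
  by move=> r; exact: exprn_continuous.
have [||u [u0 u1] umax] := @box_EVT_max R q S
    (fun t : 'rV[R]_q => \sum_(r < q) d r * t ord0 r ^+ 2) (ex_intro _ t0 St0)
      clS.
- move=> t r [_ t1]; rewrite -(@expr_le1 _ 2)// real_normK ?num_real// -t1.
  rewrite (bigD1 r)//= lerDl; apply: sumr_ge0 => ? _; exact: sqr_ge0.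
- apply: (@continuous_sum_coord (fun r x => d r * x ^+ 2)) => r x.
  by apply: cvgMl_tmp; exact: exprn_continuous.
exists (- \sum_(r < q) d r * u ord0 r ^+ 2).
  rewrite oppr_gt0 dneg//; apply/eqP => u00.
  move: u1; rewrite u00 big1 => [/eqP|r _]; first by rewrite eq_sym oner_eq0.
  by rewrite mxE expr0n.
move=> t t00; rewrite opprK.
have := sq0 t; rewrite le_eqVlt => /orP[/eqP tt0|tt0].
  rewrite -tt0 mulr0 big1// => r _.
  have /eqP : \sum_(r < q) t ord0 r ^+ 2 = 0 by [].
  rewrite psumr_eq0 => [|? _]; last exact: sqr_ge0.
  by move=> /allP/(_ r (mem_index_enum _))/eqP ->; rewrite mulr0.
have := umax _ (normalize _ t00 tt0).
under eq_bigr do rewrite mxE exprMn mulrCA.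
rewrite -mulr_sumr exprVn sqr_sqrtr ?(ltW tt0)// ler_pdivrMl//.
by rewrite mulrC.
Qed.

Context (p : nat) (c : 'I_q) (beta h : R).

(** The free energy is a sum of functions of one coordinate each. *)
Let eta (r : 'I_q) (u : R) : R := beta * u ^+ p + h * (r == c)%:R * u - u * ln
  u.
Let eta' (r : 'I_q) (u : R) : R :=
  beta * p%:R * u ^+ (p - 1) + h * (r == c)%:R - ln u - 1.

Let free_energy_eta t : free_energy p c beta h t =
  \sum_(r < q) eta r (t ord0 r).
Proof.
rewrite /free_energy /eta sumrB big_split/= mulr_sumr; congr (_ + _ - _).
rewrite (bigD1 c)//= eqxx mulr1 big1 ?addr0// => r /negbTE ->.
by rewrite mulr0 mul0r.
Qed.

Let is_derive_eta r (u : R) : 0 < u -> is_derive u 1 (eta r) (eta' r u).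
Proof.
move=> u0; have dln := is_derive1_ln u0.
apply: (is_derive_eq (is_derive_sub (is_derive_add
  (is_derive_scale (is_derive_exprn (is_derive_id u 1) p) beta)
  (is_derive_scale (is_derive_id u 1) (h * (r == c)%:R)))
  (is_derive_mul (is_derive_id u 1) dln))).
by rewrite /= /eta' subn1; field; rewrite gt_eqF.
Qed.

Let is_derive_eta' r (u : R) : 0 < u ->
  is_derive u 1 (eta' r)
    (beta * p%:R * (p%:R - 1) * u ^+ (p - 2) - u^-1).
Proof.
move=> u0; have dln := is_derive1_ln u0.
apply: (is_derive_eq (is_derive_sub (is_derive_sub (is_derive_add
  (is_derive_scale (is_derive_exprn (is_derive_id u 1) (p - 1)) (beta * p%:R))
  (is_derive_cst (h * (r == c)%:R) u 1)) dln) (is_derive_cst (1 : R) u 1))).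
rewrite /= addr0 subr0 mulr1; congr (_ - _).
by rewrite -[LHS]mulrA natr_exprn_pred; ring.
Qed.

Let continuous_eta r : continuous (eta r).
Proof.
move=> u; apply: cvgB; last exact: continuous_xlnx.
apply: cvgD; apply: cvgMl_tmp; first exact: exprn_continuous.
exact: cvg_id.
Qed.

(** Near the maximizer m the bound is Taylor's formula of order two in each
coordinate: the first-order terms add up to zero because the coordinates of
t - m do. Away from m it follows from the uniqueness of the maximizer and the
compactness of the simplex. *)
Lemma free_energy_quadratic m lam :
  unique_global_maximizer p c beta h m -> (forall r, 0 < m ord0 r) ->
  (forall r, beta * p%:R * m ord0 r ^+ (p - 1) + h * (r == c)%:R
             - ln (m ord0 r) = lam) ->
  (forall t, \sum_(r < q) t ord0 r = 0 -> t != 0 -> hessian_form p m beta t <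
    0) ->
  exists2 k : R, 0 < k & forall t, simplex t ->
    free_energy p c beta h t <= free_energy p c beta h m
      - k * \sum_(r < q) (t ord0 r - m ord0 r) ^+ 2.
Proof.
move=> [[[m0 m1] mmax] muniq] mpos mlam /neg_def_bound[k k0 Qk].
(* Half of the margin k is spent on the Taylor error, so that k / 4 is left
   after the factor 1 / 2 of the second-order term. *)
pose d r := beta * p%:R * (p%:R - 1) * m ord0 r ^+ (p - 2) - (m ord0 r)^-1.
pose taylor (r : 'I_q) (w : R) := eta r (m ord0 r + w) <=
  eta r (m ord0 r) + eta' r (m ord0 r) * w + (d r + k / 2) / 2 * w ^+ 2.
have : \forall w \near nbhs (0 : R), forall r, taylor r w.
  apply: (@filter_forall _ _ taylor (nbhs (0 : R))) => r.
  have : \forall u \near m ord0 r, eta r u <= eta r (m ord0 r) +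
      eta' r (m ord0 r) * (u - m ord0 r) + (d r + k / 2) / 2 * (u - m ord0 r)
        ^+ 2.
    apply: taylor2_upper (is_derive_eta' r (mpos r)) _;
      last by rewrite ltrDl divr_gt0.
    by apply: filterS (lt_nbhsr (mpos r)) => u u0; exact: is_derive_eta.
  move=> /nbhs_ballP[e e0 He]; apply/nbhs_ballP; exists e => // w.
  rewrite /ball/= sub0r normrN => we; have := He (m ord0 r + w).
  rewrite /= /ball/= opprD addNKr normrN => /(_ we).
  by rewrite (_ : m ord0 r + w - m ord0 r = w)//; ring.
move=> /nbhs_ballP[e /= e0 He].
have local t : simplex t -> (forall r, `|t ord0 r - m ord0 r| < e) ->
    free_energy p c beta h t <= free_energy p c beta h m
      - k / 4 * \sum_(r < q) (t ord0 r - m ord0 r) ^+ 2.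
  move=> [t0 t1] te; rewrite !free_energy_eta.
  have sum0 : \sum_(r < q) (t - m) ord0 r = 0.
    under eq_bigr do rewrite !mxE.
    by rewrite sumrB t1 m1 subrr.
  have tmE r : (t - m) ord0 r = t ord0 r - m ord0 r by rewrite !mxE.
  have Qtm : \sum_(r < q) d r * (t ord0 r - m ord0 r) ^+ 2 <=
      - k * \sum_(r < q) (t ord0 r - m ord0 r) ^+ 2.
    have := Qk _ sum0; under eq_bigr do rewrite tmE.
    by under [in leRHS]eq_bigr do rewrite tmE.
  apply: (@le_trans _ _ (\sum_(r < q) (eta r (m ord0 r) + (lam - 1) * (t - m)
    ord0 r +
     (d r + k / 2) / 2 * (t ord0 r - m ord0 r) ^+ 2))).
    apply: ler_sum => r _.
    have := He (t ord0 r - m ord0 r); rewrite /ball/= sub0r normrN =>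
      /(_ (te r) r).
    by rewrite /taylor subrKC /eta' mlam tmE.
  rewrite !big_split/=.
  have -> : \sum_(r < q) (lam - 1) * (t - m) ord0 r =
    0 by rewrite -mulr_sumr sum0 mulr0.
  rewrite addr0 lerD2l.
  have -> : \sum_(r < q) (d r + k / 2) / 2 * (t ord0 r - m ord0 r) ^+ 2 =
    (\sum_(r < q) d r * (t ord0 r - m ord0 r) ^+ 2 +
     k / 2 * \sum_(r < q) (t ord0 r - m ord0 r) ^+ 2) / 2.
    rewrite mulr_sumr -big_split mulr_suml; apply: eq_bigr => r _ /=.
    by field.
  move: Qtm; set S1 := \sum_(r < q) d r * _; set S2 := (X in - k * X) => Qtm.
  rewrite -[leRHS]/(- (k / 4 * S2)) -[X in S1 + k / 2 * X]/S2; lra.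
pose K := [set t : 'rV[R]_q | simplex t /\ e ^+ 2 <=
  \sum_(r < q) (t ord0 r - m ord0 r) ^+ 2].
have far t : simplex t -> ~ (forall r, `|t ord0 r - m ord0 r| < e) -> K t.
  move=> st /existsNP[r /negP]; rewrite -leNgt => er; split => //.
  rewrite (bigD1 r)//= ler_wpDr//; first by apply: sumr_ge0 => ? _;
    exact: sqr_ge0.
  by rewrite -[leRHS]real_normK ?num_real// lerXn2r// nnegrE ltW.
have [[t0 Kt0]|K0] := pselect (K !=set0); last first.
  exists (k / 4); first by rewrite divr_gt0.
  move=> t st; apply: local => //; apply: contrapT => /(far _ st) Kt.
  by apply: K0; exists t.
have clK : closed K.
  rewrite (_ : K = (\bigcap_(r : 'I_q) [set t : 'rV[R]_q | 0 <= t ord0 r]) `&`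
    [set t : 'rV[R]_q | \sum_(r < q) t ord0 r = 1] `&`
    [set t : 'rV[R]_q | e ^+ 2 <= \sum_(r < q) (t ord0 r - m ord0 r) ^+ 2]);
      last first.
    apply/seteqP; split => t.
      by move=> [[t0' t1] te]; split => //; split => // r _; exact: t0'.
    by move=> [[t0' t1] te]; split => //; split => // r; exact: t0'.
  apply: closedI; [apply: closedI|].
  - apply: closed_bigI => r _.
    apply: (@preimage_closed 'rV[R]_q R (fun t => t ord0 r)
      [set x : R | 0 <= x]); last exact: closed_ge.
    by move=> t _; exact: coord_continuous.
  - apply: (@closed_sum_coord (fun=> id) [set 1]); last exact: closed_eq.
    by move=> r x; exact: cvg_id.
  - apply: (@closed_sum_coord (fun r x => (x - m ord0 r) ^+ 2)
      [set x | e ^+ 2 <= x]);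
      last exact: closed_ge.
    move=> r x.
    apply: (@continuous_comp _ _ _ (fun x : R => x - m ord0 r) (fun x =>
      x ^+ 2));
      last exact: exprn_continuous.
    by apply: cvgB; [exact: cvg_id | exact: cvg_cst].
have coord_le1 t r : simplex t -> 0 <= t ord0 r <= 1.
  move=> [t0' t1]; rewrite t0'/= -t1 (bigD1 r)//= lerDl.
  by apply: sumr_ge0 => ? _; exact: t0'.
have [||u [su eu] umax] := @box_EVT_max R q K
    (fun t : 'rV[R]_q => \sum_(r < q) eta r (t ord0 r)) (ex_intro _ t0 Kt0) clK.
- move=> t r [st _]; have /andP[t0' t1] := coord_le1 t r st.
  by rewrite ger0_norm.
- by apply: continuous_sum_coord => r; exact: continuous_eta.
have um : free_energy p c beta h u < free_energy p c beta h m.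
  rewrite lt_neqAle mmax// andbT; apply/eqP => um.
  have mu : u = m.
    by apply: muniq; split => // t st; rewrite um mmax.
  move: eu; rewrite mu big1 => [|r _]; last by rewrite subrr expr0n.
  by rewrite leNgt exprn_gt0.
have q0 : 0 < q%:R :> R.
  by rewrite ltr0n; case: (q) (m) m1 => [|//] ?; rewrite big_ord0 => /eqP;
    rewrite eq_sym oner_eq0.
exists (Num.min (k / 4) ((free_energy p c beta h m - free_energy p c beta h u)
  / q%:R)).
  by rewrite lt_min !divr_gt0// subr_gt0.
move=> t st.
have sq0 : 0 <= \sum_(r < q) (t ord0 r - m ord0 r) ^+ 2.
  by apply: sumr_ge0 => ? _; exact: sqr_ge0.
have [te|te] := pselect (forall r, `|t ord0 r - m ord0 r| < e).
  apply: (le_trans (local t st te)); rewrite lerD2l lerN2 ler_wpM2r//.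
  by rewrite ge_min lexx.
have := umax _ (far _ st te); rewrite -!free_energy_eta => tu.
rewrite (le_trans tu)// lerBrDr -lerBrDl.
apply: (@le_trans _ _ ((free_energy p c beta h m - free_energy p c beta h u) /
  q%:R * q%:R)); last first.
  by rewrite divfK// gt_eqF.
rewrite ler_pM// ?le_min ?ge_min ?lexx ?orbT//.
  by rewrite !divr_ge0 ?ltW// subr_gt0.
rewrite -[q in q%:R]card_ord -sum1_card natr_sum; apply: ler_sum => r _.
rewrite -real_normK ?num_real// expr_le1// ler_norml.
have := coord_le1 _ r st; have := coord_le1 _ r (conj m0 m1).
by lra.
Qed.

End quadratic_bound.

(** * Concentration of the colour frequencies *)

Section types.
Context (R : realType) (q N : nat).
Hypothesis N_gt0 : (0 < N)%N.
Implicit Types X Y : config q N.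

Let N0 : 0 < N%:R :> R. Proof. by rewrite ltr0n. Qed.

Definition freq X : 'rV[R]_q := \row_r color_freq R X r.

Lemma sum_over_sites (f : 'I_q -> R) X :
  \sum_(i < N) f (X i) = N%:R * \sum_(r < q) color_freq R X r * f r.
Proof.
rewrite mulr_sumr.
transitivity (\sum_(r < q) \sum_(i < N) (X i == r)%:R * f r).
  rewrite exchange_big/=; apply: eq_bigr => i _.
  rewrite (bigD1 (X i))//= eqxx mul1r big1 ?addr0// => r.
  by rewrite eq_sym => /negbTE ->; rewrite mul0r.
apply: eq_bigr => r _; rewrite color_freqE -mulr_suml mulrA mulrCA.
by rewrite divff ?mulr1// gt_eqF.
Qed.

Lemma freq_simplex X : simplex (freq X).
Proof.
split=> [r|].
  by rewrite mxE color_freqE divr_ge0// sumr_ge0.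
under eq_bigr do rewrite mxE.
apply: (mulfI (lt0r_neq0 N0)); rewrite mulr1.
have := sum_over_sites (fun=> 1) X; under [in RHS]eq_bigr do rewrite mulr1.
by move=> <-; rewrite sumr_const card_ord.
Qed.

Lemma freq_ge0 X r : 0 <= color_freq R X r.
Proof. by have [+ _] := freq_simplex X => /(_ r); rewrite mxE. Qed.

Lemma sum_freq X : \sum_(r < q) color_freq R X r = 1.
Proof. by have [_ <-] := freq_simplex X; apply: eq_bigr => r _;
  rewrite mxE. Qed.

Lemma freq_le1 X r : color_freq R X r <= 1.
Proof.
by rewrite -(sum_freq X) (bigD1 r)//= lerDl sumr_ge0// => ? _; exact: freq_ge0.
Qed.

Lemma freq_gt0 X i : 0 < color_freq R X (X i).
Proof.
rewrite color_freqE divr_gt0// (bigD1 i)//= eqxx ltr_pwDl// sumr_ge0//.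
Qed.

Lemma sum_prod (f : 'I_q -> R) :
  \sum_(X : config q N) \prod_(i < N) f (X i) = (\sum_(r < q) f r) ^+ N.
Proof.
rewrite -[in RHS](card_ord N) -prodr_const (bigA_distr_bigA (fun _ => f)).
by [].
Qed.

(** The numbers of sites of each colour, in a finite type whose cardinality
bounds the number of possible frequency vectors. *)
Definition counts X : {ffun 'I_q -> 'I_N.+1} :=
  [ffun r => inord (\sum_(i < N) (X i == r))].

Lemma counts_inj X Y : counts X = counts Y -> freq X = freq Y.
Proof.
move=> XY; apply/rowP => r; rewrite !mxE !color_freqE -!natr_sum.
have cnt_le Z : (\sum_(i < N) (Z i == r) < N.+1)%N.
  rewrite ltnS -[leqRHS]card_ord -sum1_card; apply: leq_sum => i _.
  exact: leq_b1.
have := congr1 (fun k : {ffun 'I_q -> 'I_N.+1} => val (k r)) XY.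
by rewrite !ffunE /= !inordK// => ->.
Qed.
End types.

Section partition_function.
Context (R : realType) (p q : nat) (c : 'I_q) (beta h : R) (N : nat).
Hypotheses (N_gt0 : (0 < N)%N) (beta_ge0 : 0 <= beta).
Context (m : 'rV[R]_q) (lam : R).
Hypotheses (m_gt0 : forall r, 0 < m ord0 r) (m_sum : \sum_(r < q) m ord0 r = 1).
(** Stationarity of the free energy at m on the simplex. *)
Hypothesis m_stat : forall r, beta * p%:R * m ord0 r ^+ (p - 1)
  + h * (r == c)%:R - ln (m ord0 r) = lam.

Implicit Types X Y : config q N.
Let N0 : 0 < N%:R :> R. Proof. by rewrite ltr0n. Qed.

Let energy (t : 'rV[R]_q) : R := beta * (\sum_(r < q) t ord0 r ^+ p) + h * t
  ord0 c.

Let energyE t : energy t = \sum_(r < q) (beta * t ord0 r ^+ p + h * (r == c)%:R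
  * t ord0 r).
Proof.
rewrite /energy big_split/= mulr_sumr; congr (_ + _).
rewrite (bigD1 c)//= eqxx mulr1 big1 ?addr0// => r /negbTE ->.
by rewrite mulr0 mul0r.
Qed.

Let gibbs_weight_energy X :
  gibbs_weight p c beta h X = expR (N%:R * energy (freq R X)).
Proof.
rewrite /gibbs_weight /energy; congr expR; rewrite !mxE.
under [in RHS]eq_bigr do rewrite mxE.
by ring.
Qed.

(** Replacing the convex energy by its tangent at m turns the partition
function into that of a product measure, whose marginal is m itself. *)
Lemma partition_ge :
  expR (N%:R * free_energy p c beta h m) <=
  \sum_(X : config q N) gibbs_weight p c beta h X.
Proof.
have prod1 : \sum_(X : config q N) \prod_(i < N) m ord0 (X i) = 1.
  by rewrite sum_prod m_sum expr1n.
rewrite -[leLHS]mulr1 -[X in _ * X]prod1 mulr_sumr.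
apply: ler_sum => X _; rewrite gibbs_weight_energy.
rewrite (eq_bigr (fun i => expR (ln (m ord0 (X i))))); last first.
  by move=> i _; rewrite lnK// posrE.
rewrite -expR_sum -expRD ler_expR (sum_over_sites N_gt0 (fun r =>
  ln (m ord0 r))).
rewrite -mulrDr ler_pM2l// /free_energy -/(energy m) !energyE -subr_ge0.
have -> : \sum_(r < q) (beta * freq R X ord0 r ^+ p + h * (r == c)%:R * freq R
  X ord0 r) -
  (\sum_(r < q) (beta * m ord0 r ^+ p + h * (r == c)%:R * m ord0 r) -
    \sum_(r < q) m ord0 r * ln (m ord0 r) +
   \sum_(r < q) color_freq R X r * ln (m ord0 r)) =
  \sum_(r < q) (beta * pow_remainder p (m ord0 r) (color_freq R X r)
    + lam * (color_freq R X r - m ord0 r)).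
  rewrite -!sumrB -big_split -sumrB; apply: eq_bigr => r _ /=.
  by rewrite mxE /pow_remainder -(m_stat r) -subn1; ring.
have sum0 : \sum_(r < q) lam * (color_freq R X r - m ord0 r) = 0.
  by rewrite -mulr_sumr sumrB (sum_freq _ N_gt0) m_sum subrr mulr0.
rewrite big_split/= sum0 addr0.
apply: sumr_ge0 => r _; rewrite mulr_ge0// pow_remainder_ge0 ?freq_ge0//.
exact: ltW.
Qed.

(** The number of configurations of a given type is at most the exponential of
N times its entropy, because their total probability under the product of the
type is at most 1. *)
Lemma type_weight_le X :
  \sum_(Y : config q N | freq R Y == freq R X) gibbs_weight p c beta h Y <=
  expR (N%:R * free_energy p c beta h (freq R X)).
Proof.
rewrite [leLHS](_ : _ = \sum_(Y : config q N | freq R Y == freq R X)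
  expR (N%:R * free_energy p c beta h (freq R X)) *
    \prod_(i < N) color_freq R X (Y i)).
  rewrite -mulr_sumr ler_piMr ?expR_ge0//.
  apply: (@le_trans _ _ (\sum_(Y : config q N) \prod_(i < N) color_freq R X (Y
    i))).
    rewrite [leRHS](bigID (fun Y => freq R Y == freq R X))/= lerDl.
    apply: sumr_ge0 => Y _; apply: prodr_ge0 => i _; exact: freq_ge0.
  by rewrite sum_prod (sum_freq _ N_gt0) expr1n.
apply: eq_bigr => Y /eqP YX; rewrite gibbs_weight_energy YX.
have freqYX r : color_freq R Y r = color_freq R X r.
  by have := congr1 (fun t : 'rV[R]_q => t ord0 r) YX; rewrite !mxE.
rewrite (eq_bigr (fun i => expR (ln (color_freq R X (Y i))))); last first.
  by move=> i _; rewrite lnK// posrE -freqYX freq_gt0.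
rewrite -expR_sum -expRD (sum_over_sites N_gt0 (fun r =>
  ln (color_freq R X r))).
under [in RHS]eq_bigr do rewrite freqYX.
rewrite -mulrDr /free_energy -/(energy _); congr expR; congr (_ * _).
under [X in _ - X]eq_bigr do rewrite mxE.
by rewrite subrK.
Qed.

(** By the two preceding bounds a single frequency vector contributes at most B,
and there are at most (N + 1)^q of them. *)
Lemma gibbs_mean_le_types (phi : 'rV[R]_q -> R) (B : R) :
  (forall X, expR (N%:R * (free_energy p c beta h (freq R X)
                           - free_energy p c beta h m)) * phi (freq R X) <=
                             B) ->
  (forall X, 0 <= phi (freq R X)) -> 0 <= B ->
  gibbs_mean p c beta h (fun X : config q N => phi (freq R X)) <=
    N.+1%:R ^+ q * B.
Proof.
move=> phiB phi0 B0; rewrite /gibbs_mean (partition_big (@counts q N) predT)//=.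
have Z0 := partition_gt0 p c beta h N.
have classB (k : {ffun 'I_q -> 'I_N.+1}) :
    \sum_(X : config q N | counts X == k) gibbs p c beta h X * phi (freq R X)
      <= B.
  have [[X0 kX0]|noX] := pselect (exists X : config q N, counts X == k);
    last first.
    by rewrite big1// => X kX; exfalso; apply: noX; exists X.
  have freqX X : counts X == k -> freq R X = freq R X0.
    by move=> /eqP kX; apply: counts_inj => //; rewrite kX (eqP kX0).
  apply: le_trans (phiB X0).
  rewrite (eq_bigr (fun X => gibbs p c beta h X * phi (freq R X0))); last first.
    by move=> X /freqX ->.
  rewrite -mulr_suml ler_wpM2r ?phi0//.
  rewrite /gibbs -mulr_suml ler_pdivrMr//
    mulrBr expRB mulrAC ler_pdivlMr ?expR_gt0//.
  apply: ler_pM; [|exact: expR_ge0| |exact: partition_ge].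
    by apply: sumr_ge0 => X _; exact/ltW/gibbs_weight_gt0.
  apply: le_trans (type_weight_le X0).
  rewrite [leRHS](bigID (fun Y => counts Y == k))/=.
  rewrite [X in _ <= X + _](_ : _ =
    \sum_(X : config q N | counts X == k) gibbs_weight p c beta h X).
    rewrite lerDl; apply: sumr_ge0 => X _; exact/ltW/gibbs_weight_gt0.
  apply: eq_bigl => X; have [kX|//] := boolP (counts X == k);
    last by rewrite andbF.
  by rewrite (freqX _ kX) eqxx.
apply: (le_trans (ler_sum _ (fun k _ => classB k))).
by rewrite sumr_const card_ffun !card_ord -natrX mulr_natl.
Qed.

End partition_function.

Section concentration.
Context (R : realType) (p q : nat) (c : 'I_q) (beta h : R).
Context (m : 'rV[R]_q) (lam k : R).
Hypotheses (beta_ge0 : 0 <= beta) (k_gt0 : 0 < k).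
Hypotheses (m_gt0 : forall r, 0 < m ord0 r)
  (m_sum : \sum_(r < q) m ord0 r = 1).
Hypothesis m_stat : forall r, beta * p%:R * m ord0 r ^+ (p - 1)
  + h * (r == c)%:R - ln (m ord0 r) = lam.
Hypothesis m_quad : forall t, simplex t ->
  free_energy p c beta h t <= free_energy p c beta h m
    - k * \sum_(r < q) (t ord0 r - m ord0 r) ^+ 2.

(** The distance of the color frequencies from m, on the scale of their
fluctuations. *)
Definition dev (N : nat) (X : config q N) : R :=
  Num.sqrt (N%:R * \sum_(r < q) (color_freq R X r - m ord0 r) ^+ 2).

(** With l = ln (N + 1), exponents L * v up to l / 4 contribute at most
(N + 1)^(1/4). Beyond, v exceeds a multiple of l, so that exp (L v - k v^2) is
smaller than the inverse of the number of types. *)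
Lemma gibbs_mean_exp_dev (L : R) : 0 < L -> \forall N \near \oo,
  gibbs_mean p c beta h (fun X : config q N => expR (L * dev X)) <=
    expR (ln N.+1%:R / 4) + 1.
Proof.
move=> L0.
have := near_le_ln (4 * L * (L + 4 * L * q%:R) / k).
apply: filterS2 (nbhs_infty_gt 0) => N N0 lN.
set l := ln N.+1%:R in lN *.
have l0 : 0 <= l by rewrite ln_ge0// ler1n.
have EN : expR l = N.+1%:R by rewrite /l lnK// posrE ltr0n.
pose v (t : 'rV[R]_q) := Num.sqrt (N%:R * \sum_(r < q) (t ord0 r - m ord0 r) ^+
  2).
have v2 t : v t ^+ 2 = N%:R * \sum_(r < q) (t ord0 r - m ord0 r) ^+ 2.
  by rewrite sqr_sqrtr// mulr_ge0// sumr_ge0// => r _; exact: sqr_ge0.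
have devE (X : config q N) : dev X = v (freq R X).
  by rewrite /dev /v; under [in RHS]eq_bigr do rewrite mxE.
pose phi t := if l / 4 < L * v t then expR (L * v t) else 0.
apply: (@le_trans _ _ (gibbs_mean p c beta h
    (fun X : config q N => expR (l / 4) + phi (freq R X)))).
  apply: gibbs_mean_le => X; rewrite devE /phi.
  have [lL|lL] := ltP; first by rewrite lerDr expR_ge0.
  by rewrite addr0 ler_expR.
rewrite gibbs_meanD gibbs_mean_cst lerD2l.
apply: (@le_trans _ _ (N.+1%:R ^+ q * expR (- (q%:R * l)))); last first.
  by rewrite -EN -expRM_natl -expRD subrr expR0.
apply: (gibbs_mean_le_types N0 beta_ge0 m_gt0 m_sum m_stat) => [X|X|].
- rewrite /phi; case: ltP => [lL|_]; last by rewrite mulr0 expR_ge0.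
  rewrite -expRD ler_expR.
  have := m_quad (freq_simplex R N0 X).
  rewrite -lerBlDl => /(ler_wpM2l (ler0n R N)) => quad.
  apply: (le_trans (lerD quad (lexx _))).
  rewrite mulrN mulrCA -v2.
  set u := v _ in lL *.
  have u0 : 0 <= u by exact: sqrtr_ge0.
  have ul : l / (4 * L) <= u by rewrite ler_pdivrMr ?mulr_gt0//; lra.
  have ku : L + 4 * L * q%:R <= k * u.
    have : k * (l / (4 * L)) <= k * u by rewrite ler_pM2l.
    apply: le_trans; rewrite mulrA ler_pdivlMr ?mulr_gt0//.
    by move: lN; rewrite ler_pdivrMr//; lra.
  have : u * (L + 4 * L * q%:R) <= u * (k * u) by rewrite ler_wpM2l.
  have : q%:R * (l / 4) <= q%:R * (L * u) by rewrite ler_wpM2l// ltW.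
  rewrite expr2; lra.
- by rewrite /phi; case: ifP => // _; exact: expR_ge0.
- exact: expR_ge0.
Qed.

(** (N + 1)^(1/4) is negligible against the square root of N. *)
Lemma cvg_exp_dev (L : R) : 0 < L ->
  gibbs_mean p c beta h (fun X : config q N => expR (L * dev X))
    / Num.sqrt N%:R @[N --> \oo] --> (0 : R).
Proof.
move=> L0; apply/cvgrPdist_le => e e0.
have := near_le_ln (- 4 * ln (e / 4)).
apply: filterS3 (nbhs_infty_gt 0) (gibbs_mean_exp_dev L0) => N N0 bound lN.
rewrite sub0r normrN ger0_norm; last first.
  by rewrite divr_ge0 ?sqrtr_ge0// gibbs_mean_ge0// => X; exact: expR_ge0.
have sN : 0 < Num.sqrt N%:R :> R by rewrite sqrtr_gt0 ltr0n.
rewrite ler_pdivrMr// (le_trans bound)//.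
set l := ln N.+1%:R in bound lN *.
have l0 : 0 <= l by rewrite ln_ge0// ler1n.
have EN : expR l = N.+1%:R by rewrite /l lnK// posrE ltr0n.
have l2 : expR (l / 2) <= 2 * Num.sqrt N%:R.
  rewrite -(@ler_pXn2r _ 2) ?nnegrE ?expR_ge0 ?mulr_ge0 ?sqrtr_ge0//.
  rewrite exprMn sqr_sqrtr// -expRM_natl mulrC divfK// EN.
  have N1 : (0 < N)%N := N0; rewrite -natrX -natrM ler_nat (_ : (2 ^ 2 =
    4)%N)//.
  by lia.
have le4 : expR (- (l / 4)) <= e / 4.
  by rewrite -[leRHS]lnK ?posrE ?divr_gt0// ler_expR; lra.
apply: (@le_trans _ _ (2 * expR (l / 4))).
  by rewrite mulr_natl mulr2n lerD2l -expR0 ler_expR divr_ge0.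
have -> : l / 4 = l / 2 + - (l / 4) by lra.
rewrite expRD.
have : expR (l / 2) * expR (- (l / 4)) <= (2 * Num.sqrt N%:R) * (e / 4).
  by rewrite ler_pM ?expR_ge0.
lra.
Qed.

End concentration.

(** * The Stein identity of the colour frequency *)

Section jump_rate.
Context (R : realType) (p : nat) (beta h a b : R).
Hypotheses (beta_ge0 : 0 <= beta) (ab01 : [/\ 0 < a, a <= 1, 0 < b & b <= 1]).
Hypothesis stat :
  beta * p%:R * a ^+ (p - 1) + h - ln a = beta * p%:R * b ^+ (p - 1) - ln b.

(** The factor by which the Gibbs weight changes when one of the N sites is
moved from the colour c to another colour, where these colours have
frequencies y and x. *)
Definition jump_rate (N : nat) (x y : R) : R :=
  expR (beta * N%:R * ((x + N%:R^-1) ^+ p - x ^+ p + ((y - N%:R^-1) ^+ p - y ^+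
    p))
        - h).

Let A := beta * p%:R * (p%:R - 1) * b ^+ (p - 2).
Let B := beta * p%:R * (p%:R - 1) * a ^+ (p - 2).

Let unit_dist (u v : R) : 0 <= u <= 1 -> 0 <= v <= 1 -> `|u - v| <= 1.
Proof. by rewrite ler_norml => /andP[? ?] /andP[? ?]; apply/andP; split;
  lra. Qed.

Let dist2 (u e : R) : 0 <= u <= 1 -> -1 <= e <= 1 -> `|u + e| <= 2.
Proof. by rewrite ler_norml => /andP[? ?] /andP[? ?]; apply/andP; split;
  lra. Qed.

(** The logarithm of the jump rate relative to b / a, its limit at the
maximizer. *)
Let exponent (N : nat) (x y : R) : R :=
  beta * N%:R * ((x + N%:R^-1) ^+ p - x ^+ p + ((y - N%:R^-1) ^+ p - y ^+ p))
  - h - (ln b - ln a).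

Let linear_part (x y : R) : R := A * (x - b) - B * (y - a).

(** The order of magnitude of all the remainders. *)
Let err (N : nat) (x y : R) : R := (x - b) ^+ 2 + (y - a) ^+ 2 + N%:R^-1.

Let exponentE N x y : (0 < N)%N -> (1 < p)%N ->
  exponent N x y - linear_part x y =
    beta * (N%:R * pow_remainder p x (x + N%:R^-1)
            + N%:R * pow_remainder p y (y - N%:R^-1))
    + beta * p%:R * (pow_remainder (p - 1) b x - pow_remainder (p - 1) a y).
Proof.
move=> N0 p1; have NR0 : N%:R != 0 :> R by rewrite pnatr_eq0 -lt0n.
have hE : h = ln a - ln b + beta * p%:R * (b ^+ (p - 1) - a ^+ (p - 1)).
  by have := stat; lra.
rewrite /exponent /linear_part /A /B /pow_remainder hE -!subn1 -subnDA addn1.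
rewrite (natrB _ (ltnW p1)).
move: (p%:R) (ln a) (ln b) (b ^+ (p - 1)) (a ^+ (p - 1)) (x ^+ (p - 1))
  (y ^+ (p - 1)) (x ^+ p) (y ^+ p) (b ^+ (p - 2)) (a ^+ (p - 2))
  ((x + N%:R^-1) ^+ p) ((y - N%:R^-1) ^+ p) => *.
by field.
Qed.

Let exponent_estimate : (1 < p)%N -> exists2 K : R, 0 <= K &
  forall N x y, (0 < N)%N -> 0 <= x <= 1 -> 0 <= y <= 1 ->
  `|exponent N x y - linear_part x y| <= K * err N x y.
Proof.
move=> p1; have [a0 a1 b0 b1] := ab01.
have [K K0 HK] := @pow_remainder_le R p.
have [K' K'0 HK'] := @pow_remainder_le R (p - 1).
exists (2 * beta * K + beta * p%:R * K'); first by rewrite addr_ge0 ?mulr_ge0.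
move=> N x y N0 x01 y01; rewrite exponentE//.
have NR0 : 0 < N%:R :> R by rewrite ltr0n.
have e1 : -1 <= (N%:R^-1 : R) <= 1.
  by rewrite invf_le1// ler1n N0 andbT (@le_trans _ _ 0)// ?invr_ge0 ?ltW//
    lerN10.
have e1' : -1 <= - (N%:R^-1 : R) <= 1 by rewrite lerN2 lerNl andbC.
have z01 : -1 <= (0 : R) <= 1 by rewrite lerN10 ler01.
have a01 : 0 <= a <= 1 by rewrite ltW.
have b01 : 0 <= b <= 1 by rewrite ltW.
have le2 (u : R) : 0 <= u <= 1 -> `|u| <= 2.
  by move=> u01; have := dist2 u01 z01; rewrite addr0.
have sq0 (u : R) := sqr_ge0 u.
have e0 : 0 <= N%:R^-1 :> R by rewrite invr_ge0 ltW.
have scaled (u e : R) : 0 <= u <= 1 -> -1 <= e <= 1 -> e ^+ 2 = N%:R^-1 ^+ 2 ->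
    `|N%:R * pow_remainder p u (u + e)| <= K * err N x y.
  move=> u01 e01 eN; rewrite normrM normr_nat.
  apply: (@le_trans _ _ (N%:R * (K * N%:R^-1 ^+ 2))).
    rewrite ler_wpM2l// (le_trans (HK _ _ (le2 _ u01) (dist2 u01 e01)))//.
    by rewrite (addrC u) addrK eN.
  rewrite mulrCA ler_wpM2l// expr2 mulrA divff ?gt_eqF// mul1r.
  by rewrite /err lerDr addr_ge0.
have h3 : `|pow_remainder (p - 1) b x - pow_remainder (p - 1) a y|
    <= K' * err N x y.
  rewrite (le_trans (ler_normB _ _))//.
  apply: (le_trans (lerD (HK' _ _ (le2 _ b01) (le2 _ x01))
    (HK' _ _ (le2 _ a01) (le2 _ y01)))).
  by rewrite -mulrDr ler_wpM2l// /err lerDl.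
rewrite (le_trans (ler_normD _ _))// normrM (ger0_norm beta_ge0).
rewrite normrM (ger0_norm (mulr_ge0 beta_ge0 (ler0n R p))) mulrDl lerD//;
  last first.
  by rewrite -!mulrA ler_wpM2l// ler_wpM2l.
rewrite (_ : 2 * beta * K * _ = beta * (K * err N x y + K * err N x y));
  last by ring.
rewrite ler_wpM2l// (le_trans (ler_normD _ _))// lerD// scaled//.
by rewrite sqrrN.
Qed.

Let jump_rateE N x y : jump_rate N x y = b / a * expR (exponent N x y).
Proof.
have [a0 _ b0 _] := ab01.
rewrite /exponent [in RHS]expRB expRB.
rewrite (lnK (b0 : b \is Num.pos)) (lnK (a0 : a \is Num.pos)).
by rewrite mulrCA divff ?mulr1 // mulf_neq0 ?invr_eq0 ?gt_eqF.
Qed.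

Let sqrB_le (u v : R) : (u - v) ^+ 2 <= 2 * u ^+ 2 + 2 * v ^+ 2.
Proof. by have := sqr_ge0 (u + v); rewrite !expr2; lra. Qed.

Let sqrD_le (u v : R) : (u + v) ^+ 2 <= 2 * u ^+ 2 + 2 * v ^+ 2.
Proof. by have := sqr_ge0 (u - v); rewrite !expr2; lra. Qed.

Let norm_mul_le (u v : R) : `|u| * `|v| <= u ^+ 2 + v ^+ 2.
Proof.
rewrite -(real_normK (num_real u)) -(real_normK (num_real v)).
have := sqr_ge0 (`|u| - `|v|); have := sqr_ge0 (`|u|); have := sqr_ge0 (`|v|).
by rewrite !expr2; lra.
Qed.

Let A_ge0 : (1 < p)%N -> 0 <= A.
Proof.
have [a0 _ b0 _] := ab01 => p1.
by rewrite !mulr_ge0 ?exprn_ge0 ?(ltW b0)// subr_ge0 ler1n ltnW.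
Qed.

Let B_ge0 : (1 < p)%N -> 0 <= B.
Proof.
have [a0 _ b0 _] := ab01 => p1.
by rewrite !mulr_ge0 ?exprn_ge0 ?(ltW a0)// subr_ge0 ler1n ltnW.
Qed.

Let expR_exponent_estimate : (1 < p)%N -> exists2 K : R, 0 <= K &
  forall N x y, (0 < N)%N -> 0 <= x <= 1 -> 0 <= y <= 1 ->
  `|expR (exponent N x y) - (1 + linear_part x y)| <= K * err N x y.
Proof.
move=> p1; have [a0 a1 b0 b1] := ab01.
have [K1 K10 HK1] := exponent_estimate p1.
have A0 := A_ge0 p1; have B0 := B_ge0 p1.
have [K2 K20 HK2] := expR_remainder (A + B + K1 * 3).
pose K3 := 2 * (2 * A ^+ 2 + 2 * B ^+ 2) + 2 * (K1 ^+ 2 * 3).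
have sq2 (u : R) : 0 <= 2 * u ^+ 2 by rewrite mulr_ge0 ?sqr_ge0.
have K30 : 0 <= K3.
  apply: addr_ge0; apply: mulr_ge0 => //; first exact: addr_ge0.
  by rewrite mulr_ge0 ?sqr_ge0.
exists (K2 * K3 + K1); first by rewrite addr_ge0// mulr_ge0.
move=> N x y N0 x01 y01; have {HK1}zl := HK1 _ _ _ N0 x01 y01.
have a01 : 0 <= a <= 1 by rewrite ltW.
have b01 : 0 <= b <= 1 by rewrite ltW.
have xb1 := unit_dist x01 b01; have ya1 := unit_dist y01 a01.
have e0 : 0 <= N%:R^-1 :> R by rewrite invr_ge0.
have e1 : N%:R^-1 <= 1 :> R by rewrite invf_le1 ?ltr0n// ler1n.
have sq1 (u : R) : `|u| <= 1 -> u ^+ 2 <= 1.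
  by move=> u1; rewrite -real_normK ?num_real// expr_le1.
have w3 : err N x y <= 3.
  have := sq1 _ xb1; have := sq1 _ ya1; rewrite /err => ? ?.
  by rewrite (_ : 3 = 1 + 1 + 1) ?lerD//; ring.
have w0 : 0 <= err N x y by rewrite /err !addr_ge0 ?sqr_ge0.
have wx : (x - b) ^+ 2 <= err N x y by rewrite /err -addrA lerDl addr_ge0
  ?sqr_ge0.
have wy : (y - a) ^+ 2 <= err N x y.
  by rewrite /err addrAC lerDr addr_ge0 ?sqr_ge0.
have l1 : `|linear_part x y| <= A + B.
  rewrite (le_trans (ler_normB _ _))// (normrM A) (normrM B) (ger0_norm A0)
    (ger0_norm B0).
  by rewrite lerD// ler_piMr.
move: zl w0 w3 wx wy; set z := exponent N x y; set l := linear_part x y in l1 *.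
set w := err N x y => zl w0 w3 wx wy.
have zC : `|z| <= A + B + K1 * 3.
  rewrite -(subrKC l z) (le_trans (ler_normD _ _))// lerD//.
  by rewrite (le_trans zl)// ler_wpM2l.
have z2 : z ^+ 2 <= K3 * w.
  have zl2 : (z - l) ^+ 2 <= K1 ^+ 2 * 3 * w.
    rewrite -real_normK ?num_real//.
    apply: (@le_trans _ _ ((K1 * w) ^+ 2)).
      by rewrite lerXn2r// nnegrE mulr_ge0.
    by rewrite exprMn -mulrA ler_wpM2l ?sqr_ge0// expr2 ler_wpM2r.
  have l2 : l ^+ 2 <= (2 * A ^+ 2 + 2 * B ^+ 2) * w.
    have -> : (2 * A ^+ 2 + 2 * B ^+ 2) * w =
      2 * (A ^+ 2 * w) + 2 * (B ^+ 2 * w).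
      by ring.
    apply: (le_trans (sqrB_le _ _)).
    by rewrite [(A * _) ^+ 2]exprMn [(B * _) ^+ 2]exprMn lerD// ler_wpM2l//
      ler_wpM2l ?sqr_ge0.
  have := sqrD_le l (z - l); rewrite subrKC => /le_trans; apply.
  have -> : K3 * w = 2 * ((2 * A ^+ 2 + 2 * B ^+ 2) * w) + 2 * (K1 ^+ 2 * 3 *
    w).
    by rewrite /K3; ring.
  by rewrite lerD// ler_wpM2l.
rewrite (_ : _ - _ = (expR z - (1 + z)) + (z - l)); last by ring.
rewrite (le_trans (ler_normD _ _))// mulrDl lerD//.
by rewrite (le_trans (HK2 _ zC))// -mulrA ler_wpM2l.
Qed.

(** Up to order 1 / N the jump rate at (b, a) is b / a, so the drift
x - y * jump_rate vanishes there; its linear part has the coefficients of the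
Hessian of the free energy. *)
Lemma jump_estimate : (1 < p)%N -> exists2 C : R, 0 <= C &
  forall N x y, (0 < N)%N -> 0 <= x <= 1 -> 0 <= y <= 1 ->
  `|x - y * jump_rate N x y + b * ((A - b^-1) * (x - b) - (B - a^-1) * (y - a))|
    <= C * ((x - b) ^+ 2 + (y - a) ^+ 2 + N%:R^-1).
Proof.
move=> p1; have [a0 a1 b0 b1] := ab01.
have [K K0 HK] := expR_exponent_estimate p1.
have A0 := A_ge0 p1; have B0 := B_ge0 p1.
have ba0 : 0 <= b / a by rewrite divr_ge0 ?ltW.
exists (b / a * (A + B + K)).
  by apply: mulr_ge0 => //; apply: addr_ge0 => //; exact: addr_ge0.
move=> N x y N0 x01 y01; have {HK} := HK _ _ _ N0 x01 y01.
have [y0 y1] := andP y01.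
rewrite -/(err N x y) => r2K.
have -> : x - y * jump_rate N x y + b * ((A - b^-1) * (x - b) - (B - a^-1) * (y
  - a))
  = - (b / a * ((y - a) * linear_part x y
                + y * (expR (exponent N x y) - (1 + linear_part x y)))).
  rewrite jump_rateE /linear_part.
  move: (expR _) A B => E A' B'.
  by field; rewrite !gt_eqF.
rewrite normrN normrM (ger0_norm ba0) -mulrA ler_wpM2l//.
rewrite (le_trans (ler_normD _ _))// [leRHS]mulrDl lerD//; last first.
  by rewrite normrM (ger0_norm y0) (le_trans _ r2K)// ler_piMl.
have e0 : 0 <= N%:R^-1 :> R by rewrite invr_ge0.
have xy : `|y - a| * `|x - b| <= err N x y.
  by rewrite (le_trans (norm_mul_le _ _))// /err addrC lerDl.
have yy : `|y - a| * `|y - a| <= err N x y.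
  by rewrite -expr2 real_normK ?num_real// /err addrAC lerDr addr_ge0 ?sqr_ge0.
rewrite normrM (le_trans (ler_wpM2l (normr_ge0 _) (ler_normB _ _)))//.
rewrite (normrM A) (normrM B) (ger0_norm A0) (ger0_norm B0) mulrDr mulrDl
  lerD// mulrCA.
  by rewrite ler_wpM2l.
by rewrite ler_wpM2l.
Qed.
End jump_rate.

Section recoloring.
Context (R : realType) (p q : nat) (c : 'I_q) (beta h : R) (N : nat).
Hypothesis N_gt0 : (0 < N)%N.
Implicit Types X Y : config q N.

Definition recolor (i : 'I_N) (r : 'I_q) X : config q N :=
  [ffun j => if j == i then r else X j].

Lemma recolorK i r s X : X i = s -> recolor i s (recolor i r X) = X.
Proof.
move=> Xi; apply/ffunP => j; rewrite !ffunE.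
by have [->|//] := eqVneq j i.
Qed.

Lemma freq_recolor i r X s : color_freq R (recolor i r X) s =
  color_freq R X s + ((r == s)%:R - (X i == s)%:R) / N%:R.
Proof.
rewrite !color_freqE -mulrDl; congr (_ / _).
rewrite (bigD1 i)//= [in RHS](bigD1 i)//= ffunE eqxx.
rewrite (eq_bigr (fun j => (X j == s)%:R)); last first.
  by move=> j /negbTE ji; rewrite ffunE ji.
by ring.
Qed.

Lemma gibbs_recolor i r X : r != c -> X i = c ->
  gibbs p c beta h (recolor i r X) =
  gibbs p c beta h X *
    jump_rate p beta h N (color_freq R X r) (color_freq R X c).
Proof.
move=> rc Xi; have cr : (c == r) = false by rewrite eq_sym (negbTE rc).
have Nn0 : N%:R != 0 :> R by rewrite pnatr_eq0 -lt0n.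
rewrite /gibbs mulrAC; congr (_ / _); rewrite /gibbs_weight /jump_rate -expRD.
congr expR.
rewrite !(bigD1 c (P := predT))//= !(bigD1 r (P := fun s => s != c))//=.
rewrite !freq_recolor Xi !eqxx cr (negbTE rc).
rewrite (eq_bigr (fun s => color_freq R X s ^+ p)); last first.
  move=> s /andP[/negbTE sc /negbTE sr].
  by rewrite freq_recolor Xi ![_ == s]eq_sym sc sr subrr mul0r addr0.
have -> : color_freq R X c + (0 - 1) / N%:R =
  color_freq R X c - N%:R^-1 by ring.
have -> : color_freq R X r + (1 - 0) / N%:R =
  color_freq R X r + N%:R^-1 by ring.
by field.
Qed.

Let sum_sites_if r X (K : R) :
  \sum_(i < N) (if X i == r then K / N%:R else 0) = color_freq R X r * K.
Proof.
rewrite color_freqE mulrAC -mulrA mulr_suml; apply: eq_bigr => i _.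
by case: eqP => _; rewrite ?mul0r ?mul1r.
Qed.

(** Changing the colour of a site from c to r is a bijection between the
configurations in which that site has colour c and those in which it has colour
r. *)
Lemma swap_identity (r : 'I_q) (g : R -> R) : r != c ->
  gibbs_mean p c beta h (fun X : config q N =>
    color_freq R X r * g (color_freq R X c)) =
  gibbs_mean p c beta h (fun X : config q N => color_freq R X c *
    jump_rate p beta h N (color_freq R X r) (color_freq R X c)
      * g (color_freq R X c - N%:R^-1)).
Proof.
move=> rc; have cr : (c == r) = false by rewrite eq_sym (negbTE rc).
rewrite /gibbs_mean.
transitivity (\sum_(i < N) \sum_(X : config q N | X i == r)
    gibbs p c beta h X * g (color_freq R X c) / N%:R).
  under [in RHS]eq_bigr do rewrite big_mkcond.
  rewrite exchange_big/=; apply: eq_bigr => X _.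
  by rewrite sum_sites_if mulrCA.
transitivity (\sum_(i < N) \sum_(X : config q N | X i == c)
    gibbs p c beta h X * jump_rate p beta h N (color_freq R X r) (color_freq R
      X c)
      * g (color_freq R X c - N%:R^-1) / N%:R).
  apply: eq_bigr => i _.
  rewrite (reindex_onto (recolor i r) (recolor i c))/=; last first.
    by move=> X /eqP Xi; exact: recolorK.
  have E X : (recolor i r X i == r) && (recolor i c (recolor i r X) == X)
      = (X i == c).
    rewrite ffunE eqxx eqxx/=; apply/eqP/eqP => [<-|Xi]; last exact: recolorK.
    by rewrite ffunE eqxx.
  rewrite (eq_bigl _ _ E); apply: eq_bigr => X /eqP Xi.
  rewrite gibbs_recolor// freq_recolor Xi eqxx (negbTE rc).
  by rewrite sub0r mulN1r.
under eq_bigr do rewrite big_mkcond.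
rewrite exchange_big/=; apply: eq_bigr => X _.
by rewrite sum_sites_if; ring.
Qed.

End recoloring.

Section stein_identity.
Context (R : realType) (p q : nat) (c : 'I_q) (beta h a b : R).
Hypotheses (p_ge2 : (1 < p)%N) (q_ge2 : (1 < q)%N) (beta_ge0 : 0 <= beta).
Hypotheses (ab01 : [/\ 0 < a, a <= 1, 0 < b & b <= 1])
  (ab_sum : a + (q%:R - 1) * b = 1).
Hypothesis stat :
  beta * p%:R * a ^+ (p - 1) + h - ln a = beta * p%:R * b ^+ (p - 1) - ln b.

Definition two_values : 'rV[R]_q := \row_r (if r == c then a else b).

Let da := beta * p%:R * (p%:R - 1) * a ^+ (p - 2) - a^-1.
Let db := beta * p%:R * (p%:R - 1) * b ^+ (p - 2) - b^-1.

(** Minus the second derivative of the free energy along the direction that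
raises the coordinate c and lowers the others equally. *)
Definition curvature : R := - (da + db / (q%:R - 1)).

Definition fluct (N : nat) (X : config q N) : R :=
  Num.sqrt N%:R * (color_freq R X c - a).

Local Notation E := (gibbs_mean p c beta h).
Local Notation dev := (dev two_values).

Let q1_gt0 : 0 < q%:R - 1 :> R. Proof. by rewrite subr_gt0 ltr1n. Qed.

Section fixed_size.
Context (N : nat).
Hypothesis N_gt0 : (0 < N)%N.
Implicit Types X : config q N.

Let N0 : 0 < N%:R :> R. Proof. by rewrite ltr0n. Qed.
Let s := Num.sqrt N%:R : R.
Let s_gt0 : 0 < s. Proof. by rewrite sqrtr_gt0. Qed.
Let s2 : s ^+ 2 = N%:R. Proof. by rewrite sqr_sqrtr// ltW. Qed.

Lemma dev_ge0 X : 0 <= dev X. Proof. exact: sqrtr_ge0. Qed.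

Let sum_sq X := \sum_(r < q) (color_freq R X r - two_values ord0 r) ^+ 2.

Let dev2 X : dev X ^+ 2 = N%:R * sum_sq X.
Proof.
rewrite sqr_sqrtr// mulr_ge0//; apply: sumr_ge0 => r _; exact: sqr_ge0.
Qed.

Lemma norm_freq_le X r : `|color_freq R X r - two_values ord0 r| <= dev X / s.
Proof.
rewrite ler_pdivlMr// -(@ler_pXn2r _ 2) ?nnegrE ?mulr_ge0 ?dev_ge0 ?(ltW
  s_gt0)//.
rewrite exprMn s2 dev2 mulrC ler_pM2l// real_normK ?num_real//.
by rewrite /sum_sq (bigD1 r)//= lerDl; apply: sumr_ge0 => ? _; exact: sqr_ge0.
Qed.

Lemma norm_fluct_le X : `|fluct X| <= dev X.
Proof.
rewrite /fluct normrM (gtr0_norm s_gt0) mulrC -ler_pdivlMr//.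
by have := norm_freq_le X c; rewrite mxE eqxx.
Qed.

Let dev2_ge X r : r != c ->
  (color_freq R X r - b) ^+ 2 + (color_freq R X c - a) ^+ 2 <=
    dev X ^+ 2 / N%:R.
Proof.
move=> rc; rewrite dev2 mulrC mulrA mulVf ?gt_eqF// mul1r /sum_sq.
rewrite (bigD1 c)//= (bigD1 r)//= !mxE eqxx (negbTE rc) [leLHS]addrC
  [leRHS]addrA lerDl.
by apply: sumr_ge0 => ? _; exact: sqr_ge0.
Qed.

Let exp2_ge X : dev X ^+ 2 + 1 <= expR (2 * dev X).
Proof.
apply: le_trans (sqr1D_le_expR (dev_ge0 X)).
by have := dev_ge0 X; rewrite !expr2; lra.
Qed.

Let J X r := jump_rate p beta h N (color_freq R X r) (color_freq R X c).

Let err X r := color_freq R X r - color_freq R X c * J X r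
  + b * (db * (color_freq R X r - b) - da * (color_freq R X c - a)).

Let D (g : R -> R) X := s * (g (fluct X) - g (fluct X - s^-1)).

(** The frequencies add up to 1, as do a and q - 1 times b; this is where the
other coordinates disappear. *)
Let sum_off_c X :
  \sum_(r < q | r != c) (color_freq R X r - b) = - (color_freq R X c - a).
Proof.
have := sum_freq R N_gt0 X; rewrite (bigD1 c)//= => sumX.
rewrite sumrB sumr_neq_const.
by have := ab_sum; lra.
Qed.

(** The sum over r of the swapped terms, reorganized around their linear
part. *)
Let pointwise g X : b * (q%:R - 1) * (D g X - curvature * fluct X * g (fluct
  X)) =
  s * (\sum_(r < q | r != c) (color_freq R X r * g (fluct X)
        - color_freq R X c * J X r * g (fluct X - s^-1)))
  - \sum_(r < q | r != c) (s * err X r * g (fluct X)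
        + (color_freq R X c * J X r - b) * D g X).
Proof.
rewrite mulr_sumr -sumrB.
rewrite (eq_bigr (fun r => (b * D g X + s * b * g (fluct X) * da *
   (color_freq R X c - a)) + - (s * b * g (fluct X) * db) * (color_freq R X r -
     b)));
  last by move=> r _; rewrite /err /D; ring.
rewrite big_split/= -mulr_sumr sum_off_c sumr_neq_const.
rewrite /curvature /fluct -/s; field.
by rewrite gt_eqF.
Qed.

Let mean_swap g r : r != c ->
  E (fun X => color_freq R X r * g (fluct X)
        - color_freq R X c * J X r * g (fluct X - s^-1)) = 0.
Proof.
move=> rc; rewrite gibbs_meanB.
rewrite (swap_identity p beta h N_gt0 (fun u => g (s * (u - a))) rc).
apply/eqP; rewrite subr_eq0; apply/eqP; apply: eq_bigr => X _.
rewrite /J /fluct -/s; congr (_ * (_ * g _)).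
by rewrite -s2; field; rewrite gt_eqF.
Qed.

Let exp2_ge' X : 2 * dev X + 1 <= expR (2 * dev X).
Proof. by rewrite addrC expR_ge1Dx. Qed.

Let sV_gt0 : 0 < s^-1. Proof. by rewrite invr_gt0. Qed.

Let NV_le : N%:R^-1 <= s^-1 :> R.
Proof.
rewrite lef_pV2 ?posrE// -s2 expr2 ler_peMl ?(ltW s_gt0)//.
by rewrite -(@expr_ge1 _ 2) ?(ltW s_gt0)// s2 ler1n.
Qed.

Context (C0 : R).
Hypothesis C0_ge0 : 0 <= C0.
Hypothesis err_le : forall X r, `|err X r| <= C0 *
  ((color_freq R X r - b) ^+ 2 + (color_freq R X c - a) ^+ 2 + N%:R^-1).

Let drift_error X r : r != c -> `|s * err X r| <= C0 * (expR (2 * dev X) / s).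
Proof.
move=> rc; rewrite normrM (gtr0_norm s_gt0).
apply: (@le_trans _ _ (s * (C0 * (expR (2 * dev X) / N%:R)))).
  rewrite ler_wpM2l ?(ltW s_gt0)// (le_trans (err_le X r))// ler_wpM2l//.
  apply: (@le_trans _ _ ((dev X ^+ 2 + 1) / N%:R)).
    by rewrite mulrDl mul1r lerD2r dev2_ge.
  by rewrite ler_pM2r ?invr_gt0.
by rewrite le_eqVlt; apply/orP; left; apply/eqP; rewrite -s2; field;
  rewrite gt_eqF.
Qed.

Let C1 := 1 + b * `|db| + b * `|da| + 2 * C0.

Let linear_bound (k k' C F u v e w : R) : 0 <= w ->
  `|u| <= F -> `|v| <= F -> `|e| <= C * (2 * F) ->
  `|u + (w * (k * u) - w * (k' * v)) - e| <=
    (1 + w * `|k| + w * `|k'| + 2 * C) * F.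
Proof.
move=> w0 uF vF eF.
rewrite (le_trans (ler_normB _ _))// [leRHS]mulrDl lerD//; last first.
  by rewrite (le_trans eF)// mulrA (mulrC C).
rewrite (le_trans (ler_normD _ _))// -[in leRHS]addrA [leRHS]mulrDl mul1r
  lerD//.
rewrite (le_trans (ler_normB _ _))// [leRHS]mulrDl !normrM (ger0_norm w0)
  !mulrA.
by rewrite lerD// ler_wpM2l// mulr_ge0.
Qed.

Let jump_error X r : r != c ->
  `|color_freq R X c * J X r - b| <= C1 * (expR (2 * dev X) / s).
Proof.
move=> rc; have [_ _ b0 _] := ab01.
have := err_le X r.
have -> : color_freq R X c * J X r - b = (color_freq R X r - b)
  + (b * (db * (color_freq R X r - b)) - b * (da * (color_freq R X c - a)))
  - err X r by rewrite /err; ring.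
have xb : `|color_freq R X r - b| <= dev X / s.
  by have := norm_freq_le X r; rewrite mxE (negbTE rc).
have ya : `|color_freq R X c - a| <= dev X / s.
  by have := norm_freq_le X c; rewrite mxE eqxx.
have [a0 a1 _ b1] := ab01.
have abs1 (u v : R) : 0 <= u <= 1 -> 0 <= v <= 1 -> `|u - v| <= 1.
  by rewrite ler_norml => /andP[? ?] /andP[? ?]; apply/andP; split; lra.
have freq01 r' : 0 <= color_freq R X r' <= 1.
  by rewrite freq_ge0// freq_le1.
have xb1 : `|color_freq R X r - b| <= 1 by rewrite abs1// ltW.
have ya1 : `|color_freq R X c - a| <= 1 by rewrite abs1// ltW.
move: (err X r) (color_freq R X r - b) (color_freq R X c - a) xb ya xb1 ya1.
move=> e u v ub vb u1 v1 eC.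
have sq (w : R) : `|w| <= 1 -> w ^+ 2 <= `|w|.
  by move=> w1; rewrite -real_normK ?num_real// expr2 ler_piMl.
set d := dev X / s in ub vb.
have F : 2 * d + s^-1 <= expR (2 * dev X) / s.
  rewrite (_ : 2 * d + s^-1 = (2 * dev X + 1) / s); last first.
    by rewrite /d; field; rewrite gt_eqF.
  by rewrite ler_pM2r.
have d0 : 0 <= d by rewrite divr_ge0 ?dev_ge0 ?ltW.
have e' : `|e| <= C0 * (2 * (expR (2 * dev X) / s)).
  rewrite (le_trans eC)// ler_wpM2l//.
  have := sq _ u1; have := sq _ v1; have := NV_le; have := sV_gt0 => ? ? ? ?.
  lra.
have dF : d <= expR (2 * dev X) / s by have := sV_gt0 => ?; lra.
exact: linear_bound (ltW b0) (le_trans ub dF) (le_trans vb dF) e'.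
Qed.

(** The drift is known up to a quadratic error and the jump rate up to a linear
one; on the scale of [dev] both are of order 1 / sqrt N. *)
Lemma stein_error (g : R -> R) :
  `|E (fun X => D g X - curvature * fluct X * g (fluct X))| <=
  (C0 + C1) / b *
    (E (fun X => expR (2 * dev X) * (`|g (fluct X)| + `|D g X|)) / s).
Proof.
have [_ _ b0 _] := ab01.
have C10 : 0 <= C1 by rewrite !addr_ge0// mulr_ge0 ?(ltW b0).
rewrite mulrAC ler_pdivlMr// -(ler_pM2r q1_gt0).
rewrite -[X in X <= _](_ : `|E (fun X => b * (q%:R - 1) *
   (D g X - curvature * fluct X * g (fluct X)))| = _); last first.
  by rewrite gibbs_meanZ normrM gtr0_norm ?mulr_gt0//; ring.
pose T X r := s * err X r * g (fluct X)
        + (color_freq R X c * J X r - b) * D g X.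
have -> : E (fun X => b * (q%:R - 1) *
   (D g X - curvature * fluct X * g (fluct X))) =
   - E (fun X => \sum_(r < q | r != c) T X r).
  rewrite (_ : (fun X => b * (q%:R - 1) * _) = (fun X =>
    s * (\sum_(r < q | r != c) (color_freq R X r * g (fluct X)
        - color_freq R X c * J X r * g (fluct X - s^-1)))
    - \sum_(r < q | r != c) T X r)); last by apply/funext => X;
      exact: pointwise.
  rewrite gibbs_meanB gibbs_meanZ [X in s * X](_ : _ = 0) ?mulr0 ?sub0r//.
  rewrite /gibbs_mean; under eq_bigr do rewrite mulr_sumr.
  rewrite exchange_big/= big1// => r rc; exact: mean_swap.
rewrite normrN (le_trans (gibbs_mean_norm _ _ _ _ _))//.
rewrite (_ : (C0 + C1) * _ * _ = E (fun X => (q%:R - 1) * ((C0 + C1) *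
    (expR (2 * dev X) / s * (`|g (fluct X)| + `|D g X|))))); last first.
  rewrite 2!gibbs_meanZ [LHS]mulrC; congr (_ * (_ * _)).
  rewrite [LHS]mulrC -gibbs_meanZ; apply: eq_bigr => X _; ring.
apply: gibbs_mean_le => X; rewrite (le_trans (ler_norm_sum _ _ _))//.
apply: (@le_trans _ _ (\sum_(r < q | r != c) (C0 + C1) *
    (expR (2 * dev X) / s * (`|g (fluct X)| + `|D g X|)))).
  apply: ler_sum => r rc; rewrite /T (le_trans (ler_normD _ _))//.
  rewrite [X in _ <= _ * X]mulrDr [leRHS]mulrDr lerD// normrM mulrA.
    by rewrite ler_wpM2r// (le_trans (drift_error X rc))// ler_wpM2r ?lerDl//
      divr_ge0 ?expR_ge0 ?ltW.
  by rewrite ler_wpM2r// (le_trans (jump_error X rc))// ler_wpM2r ?lerDr//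
      divr_ge0 ?expR_ge0 ?ltW.
by rewrite sumr_neq_const.
Qed.
End fixed_size.

Hypothesis conc : forall L : R, 0 < L ->
  E (fun X : config q N => expR (L * dev X)) / Num.sqrt N%:R @[N --> \oo]
    --> (0 : R).

(** The growth conditions concern the attained values of the fluctuation only;
this leaves room for functions g with a corner between two of them. *)
Lemma cvg_stein (g : nat -> R -> R) (K L : R) : 0 <= K -> 0 <= L ->
  (\forall N \near \oo, forall X : config q N,
     `|g N (fluct X)| <= K * expR (L * `|fluct X|) /\
     `|Num.sqrt N%:R * (g N (fluct X) - g N (fluct X - (Num.sqrt N%:R)^-1))|
       <= K * expR (L * `|fluct X|)) ->
  E (fun X : config q N =>
      Num.sqrt N%:R * (g N (fluct X) - g N (fluct X - (Num.sqrt N%:R)^-1))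
      - curvature * fluct X * g N (fluct X)) @[N --> \oo] --> (0 : R).
Proof.
move=> K0 L0 gK; have [C0 C00 HC0] := jump_estimate beta_ge0 ab01 stat p_ge2.
have L2 : 0 < L + 2 by rewrite ltr_wpDl.
have [C C_ge0 HC] : exists2 C : R, 0 <= C & forall N (g : R -> R), (0 < N)%N ->
  `|E (fun X : config q N =>
      Num.sqrt N%:R * (g (fluct X) - g (fluct X - (Num.sqrt N%:R)^-1))
      - curvature * fluct X * g (fluct X))| <=
  C * (E (fun X : config q N => expR (2 * dev X) * (`|g (fluct X)| +
     `|Num.sqrt N%:R * (g (fluct X) - g (fluct X - (Num.sqrt N%:R)^-1))|))
       / Num.sqrt N%:R).
  have [_ _ b0 _] := ab01.
  eexists; last first.
    move=> N g' N0; apply: (stein_error N0 C00) => X r.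
    by apply: HC0 => //; rewrite freq_ge0// freq_le1.
  by rewrite divr_ge0 ?(ltW b0)// !addr_ge0// mulr_ge0// ltW.
have lim0 : C * (2 * K) * (E (fun X : config q N => expR ((L + 2) * dev X))
    / Num.sqrt N%:R) @[N --> \oo] --> (0 : R).
  by rewrite -[X in _ --> X](mulr0 (C * (2 * K))); apply: cvgMl_tmp;
    exact: conc.
apply/norm_cvg0P; apply: squeeze_cvgr lim0; last exact: cvg_cst.
apply: filterS2 (nbhs_infty_gt 0) gK => N N0 gK; rewrite normr_ge0/=.
rewrite (le_trans (HC _ _ N0))// -!mulrA ler_wpM2l// !mulrA.
rewrite ler_pM2r ?invr_gt0 ?sqrtr_gt0 ?ltr0n// -gibbs_meanZ.
apply: gibbs_mean_le => X; rewrite (mulrDl L) expRD.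
have gX : forall w, w <= K * expR (L * `|fluct X|) -> w <= K * expR (L * dev X).
  move=> w /le_trans; apply; rewrite ler_wpM2l// ler_expR ler_wpM2l//.
  exact: norm_fluct_le.
have [gXK DgXK] := gK X; have := lerD (gX _ gXK) (gX _ DgXK).
move=> /(ler_wpM2l (expR_ge0 (2 * dev X))) /le_trans; apply.
by rewrite le_eqVlt; apply/orP; left; apply/eqP; ring.
Qed.
End stein_identity.

(** * The central limit theorem *)

Section central_limit.
Context (R : realType) (p q : nat) (c : 'I_q) (beta h a b : R).
Hypotheses (p_ge2 : (1 < p)%N) (q_ge2 : (1 < q)%N) (beta_ge0 : 0 <= beta).
Hypotheses (ab01 : [/\ 0 < a, a <= 1, 0 < b & b <= 1])
  (ab_sum : a + (q%:R - 1) * b = 1).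
Hypothesis stat :
  beta * p%:R * a ^+ (p - 1) + h - ln a = beta * p%:R * b ^+ (p - 1) - ln b.

Local Notation E := (gibbs_mean p c beta h).
Local Notation dev := (dev (two_values c a b)).
Local Notation fluct := (fluct c a).
Context (kappa : R).
Hypothesis kappaE : curvature p q beta a b = kappa.

Hypothesis kappa_gt0 : 0 < kappa.
Hypothesis conc : forall L : R, 0 < L ->
  E (fun X : config q N => expR (L * dev X)) / Num.sqrt N%:R @[N --> \oo]
    --> (0 : R).

Let sd := Num.sqrt kappa.
Let sd_neq0 : sd != 0. Proof. by rewrite gt_eqF// sqrtr_gt0. Qed.
Let sd2 : sd ^+ 2 = kappa. Proof. by rewrite sqr_sqrtr// ltW. Qed.

(** The largest value at most y of the scaled fluctuation on the lattice of its
possible values. *)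
Let lattice_point (N : nat) (y : R) : R :=
  kappa * (Num.sqrt N%:R *
    ((Num.floor (N%:R * a + Num.sqrt N%:R * y / kappa))%:~R / N%:R - a)).

Section fixed_size.
Context (N : nat).
Hypothesis N_gt0 : (0 < N)%N.
Let N0 : 0 < N%:R :> R. Proof. by rewrite ltr0n. Qed.
Let s := Num.sqrt N%:R : R.
Let s_gt0 : 0 < s. Proof. by rewrite sqrtr_gt0. Qed.
Let s2 : s ^+ 2 = N%:R. Proof. by rewrite sqr_sqrtr// ltW. Qed.

Let freqE (X : config q N) :
  exists k : int, color_freq R X c = k%:~R / N%:R.
Proof.
exists (\sum_(i < N) (X i == c))%:Z.
by rewrite color_freqE -pmulrn natr_sum.
Qed.

(** Neighbouring values of kappa * W differ by kappa / s, so one step down from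
a value above y does not go below the lattice point. *)
Lemma lattice_point_split (y : R) (X : config q N) :
  if kappa * fluct X <= y then kappa * fluct X <= lattice_point N y
  else lattice_point N y <= kappa * fluct X - kappa / s.
Proof.
have [k kE] := freqE X; rewrite /lattice_point /fluct kE -/s.
set z := N%:R * a + s * y / kappa.
have -> : (kappa * (s * (k%:~R / N%:R - a)) <= y) = (k%:~R <= z).
  rewrite -(ler_pM2l (_ : 0 < s / kappa)) ?divr_gt0//.
  rewrite -[in RHS](lerD2r (- (N%:R * a))) /z.
  congr (_ <= _); last by ring.
  by rewrite -s2; field; rewrite !gt_eqF.
case: ifPn => kz.
  rewrite ler_pM2l// ler_pM2l// lerD2r ler_pM2r ?invr_gt0// ler_int.
  by rewrite floor_ge_int.
rewrite -mulrBr ler_pM2l// -subr_ge0.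
have -> : s * (k%:~R / N%:R - a) - s^-1 - s * ((Num.floor z)%:~R / N%:R - a) =
  (k - 1 - Num.floor z)%:~R / s.
  by rewrite !intrD !rmorphN /= -s2; field; rewrite !gt_eqF.
rewrite divr_ge0 ?(ltW s_gt0)// ler0z.
have : (Num.floor z < k)%R.
  by rewrite -(ltr_int R) (le_lt_trans (floor_le _))// ltNge.
by lia.
Qed.

Lemma lattice_point_near (y : R) :
  `|y - lattice_point N y| <= kappa / s.
Proof.
set z := N%:R * a + s * y / kappa.
have -> : y - lattice_point N y = kappa / s * (z - (Num.floor z)%:~R).
  by rewrite /lattice_point -/s -/z /z -s2; field; rewrite !gt_eqF.
have /andP[z0 z1] := floor_itv z.
rewrite normrM (gtr0_norm (divr_gt0 kappa_gt0 s_gt0)).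
rewrite ler_piMr ?divr_ge0 ?(ltW kappa_gt0) ?(ltW s_gt0)//.
rewrite ger0_norm ?subr_ge0//; move: z1; rewrite intrD; lra.
Qed.

(** Stein's equation for the half-line ending at a lattice point. *)
Lemma stein_step (y : R) (C : R) (X : config q N) : kappa / s <= 1 ->
  (forall u e : R, 0 <= e <= 1 ->
     u <= lattice_point N y \/ lattice_point N y <= u - e ->
    `|stein_solution sd (lattice_point N y) u
      - stein_solution sd (lattice_point N y) (u - e)
      - e * (u / sd ^+ 2 * stein_solution sd (lattice_point N y) u
        + ((u <= lattice_point N y)%R%:R - normal_cdf sd (lattice_point N y)))|
      <= C * e ^+ 2 * (1 + `|u|) ^+ 2) ->
  let G := fun w => stein_solution sd (lattice_point N y) (kappa * w) in
  let w := fluct X in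
  `|s * (G w - G (w - s^-1)) - kappa * w * G w
    - kappa * ((kappa * w <= y)%R%:R - normal_cdf sd (lattice_point N y))|
  <= C * kappa ^+ 2 * (1 + `|kappa * w|) ^+ 2 / s.
Proof.
move=> e1 HC; cbv zeta; set G := fun w : R => _; set w := fluct X.
have := lattice_point_split y X; rewrite -/w => split_w.
have e0 : 0 < kappa / s by rewrite divr_gt0.
have iff_w : (kappa * w <= y) = (kappa * w <= lattice_point N y).
  move: split_w; case: ifPn => _ hw; first by rewrite hw.
  by apply/esym/negbTE; rewrite -ltNge; lra.
have yu : kappa * w <= lattice_point N y \/
    lattice_point N y <= kappa * w - kappa / s.
  by move: split_w; case: ifPn => _ hw; [left | right].
have e01 : 0 <= kappa / s <= 1 by rewrite ltW.
have := HC _ _ e01 yu => /(ler_wpM2l (ltW s_gt0)).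
rewrite -[X in X * _ <= _ -> _](gtr0_norm s_gt0) -normrM.
rewrite (_ : kappa * w - kappa / s = kappa * (w - s^-1)); last by ring.
rewrite -iff_w sd2 -/(G w) -/(G (w - s^-1)).
set d := _ - normal_cdf _ _.
rewrite (_ : s * (G w - _ - _) = s * (G w - G (w - s^-1)) - kappa * w * G w
  - kappa * d); last by field; rewrite !gt_eqF.
rewrite (_ : s * (C * _ * _) = C * kappa ^+ 2 * (1 + `|kappa * w|) ^+ 2 / s)//.
by field; rewrite gt_eqF.
Qed.
End fixed_size.

(** The threshold may move with N, because the bounds on the Stein solution are
uniform in the end point of the half-line. *)
Lemma cvg_cdf_fluct (y : nat -> R) (x : R) : y N @[N --> \oo] --> x ->
  E (fun X : config q N => (kappa * fluct X <= y N)%R%:R) @[N --> \oo]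
    --> normal_cdf sd x.
Proof.
move=> yx; pose y' N := lattice_point N (y N).
have sV0 := @cvg_sqrtnV R.
have y'x : y' N @[N --> \oo] --> x.
  rewrite (_ : y' = fun N => y N - (y N - y' N)); last first.
    by apply/funext => N; rewrite subKr.
  rewrite -[X in _ --> X]subr0; apply: cvgB => //.
  apply/norm_cvg0P.
  apply: squeeze_cvgr (cvgn_scale0 kappa sV0); last exact: cvg_cst.
  apply: filterS (nbhs_infty_gt 0) => N N0; rewrite normr_ge0/=.
  exact: lattice_point_near.
have [C C0 HC] := stein_solution_step sd_neq0.
have [C' HC'] := stein_solution_bounded sd_neq0.
have C'0 : 0 <= C' by exact: le_trans (HC' 0 0).
pose g N w := stein_solution sd (y' N) (kappa * w).
pose D N (X : config q N) := Num.sqrt N%:R * (g N (fluct X) - g N (fluct X -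
  (Num.sqrt N%:R)^-1)).
pose ind N (X : config q N) : R := (kappa * fluct X <= y N)%R%:R.
have small_step : \forall N \near \oo, kappa / Num.sqrt N%:R <= 1.
  exact: (cvgr_le 0 (cvgn_scale0 kappa sV0) 1 ltr01).
have step : \forall N \near \oo, forall X : config q N,
    `|D N X - kappa * fluct X * g N (fluct X)
      - kappa * (ind N X - normal_cdf sd (y' N))|
    <= C * kappa ^+ 2 * expR (2 * (kappa * `|fluct X|)) / Num.sqrt N%:R.
  apply: filterS2 (nbhs_infty_gt 0) small_step => N N0 N1 X.
  apply: (le_trans (stein_step N0 X N1 (fun u e => HC (y' N) u e))).
  rewrite ler_wpM2r ?invr_ge0 ?sqrtr_ge0//.
  apply: ler_wpM2l; first by rewrite mulr_ge0// sqr_ge0.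
  rewrite normrM (gtr0_norm kappa_gt0) sqr1D_le_expR//.
  by rewrite mulr_ge0// ltW.
have main : E (fun X : config q N => D N X - kappa * fluct X * g N (fluct X))
    @[N --> \oo] --> (0 : R).
  rewrite -kappaE.
  apply: (@cvg_stein R p q c beta h a b p_ge2 q_ge2 beta_ge0 ab01 ab_sum stat
    conc g
    (C' + (kappa * (C' + 1) + C * kappa ^+ 2)) (2 * kappa + 1)).
  - by rewrite !addr_ge0 ?mulr_ge0 ?sqr_ge0 ?addr_ge0// ltW.
  - by rewrite addr_ge0// mulr_ge0// ltW.
  apply: filterS2 (nbhs_infty_gt 0) step => N N0 stepN X.
  have {stepN} := stepN X; rewrite -/(D N X).
  have := HC' (y' N) (kappa * fluct X); rewrite -/(g N (fluct X)).
  set w := fluct X; set e1 := expR ((2 * kappa + 1) * `|w|) => gw stepw.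
  have w0 := normr_ge0 w; have kw : 0 <= kappa * `|w| by rewrite mulr_ge0// ltW.
  have e1_ge1 : 1 <= e1 by rewrite -expR0 ler_expR mulr_ge0// addr_ge0//
    mulr_ge0// ltW.
  have e1_gew : `|w| <= e1.
    have h1 : `|w| <= expR `|w| by rewrite (le_trans _ (expR_ge1Dx _))// lerDr.
    by rewrite (le_trans h1)// ler_expR (mulrDl (2 * kappa)) mul1r lerDr -mulrA
      mulr_ge0.
  have e1_ge2 : expR (2 * (kappa * `|w|)) <= e1.
    by rewrite ler_expR (mulrDl (2 * kappa)) mul1r -mulrA lerDl.
  have k0 := ltW kappa_gt0.
  have Ck0 : 0 <= C * kappa ^+ 2 by rewrite mulr_ge0// sqr_ge0.
  have kC0 : 0 <= kappa * (C' + 1) by rewrite mulr_ge0// addr_ge0.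
  rewrite mulrDl; split.
    rewrite (le_trans gw)// ler_wpDr ?ler_peMr//.
    by rewrite mulr_ge0 ?expR_ge0// addr_ge0.
  rewrite ler_wpDl ?mulr_ge0 ?expR_ge0// mulrDl.
  set ind1 := ind N X - normal_cdf sd (y' N) in stepw.
  have ind1_le : `|ind1| <= 1.
    have F0 := normal_cdf_ge0 sd (y' N); have F1 := normal_cdf_le1 sd (y' N).
    rewrite /ind1 /ind ler_norml; case: (kappa * fluct X <= y N) => /=;
      by apply/andP; split; lra.
  rewrite [X in `|X|](_ : _ = (kappa * w * g N w + kappa * ind1)
    + (D N X - kappa * w * g N w - kappa * ind1)); last by rewrite /D; ring.
  rewrite (le_trans (ler_normD _ _))// lerD//; last first.
    rewrite (le_trans stepw)//.
    apply: (@le_trans _ _ (C * kappa ^+ 2 * expR (2 * (kappa * `|w|)))).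
      rewrite ler_piMr ?mulr_ge0 ?expR_ge0// invf_le1 ?sqrtr_gt0 ?ltr0n//.
      by rewrite -(@expr_ge1 _ 2) ?sqrtr_ge0// sqr_sqrtr// ler1n.
    by rewrite ler_wpM2l.
  rewrite (le_trans (ler_normD _ _))// -mulrA (normrM kappa) (normrM kappa)
    (normrM w).
  rewrite (gtr0_norm kappa_gt0).
  rewrite (_ : kappa * (C' + 1) * e1 = kappa * (e1 * C') + kappa * e1);
    last by ring.
  apply: lerD; apply: ler_wpM2l => //; first exact: ler_pM.
  exact: le_trans ind1_le _.
have rest : E (fun X : config q N => D N X - kappa * fluct X * g N (fluct X)
      - kappa * (ind N X - normal_cdf sd (y' N))) @[N --> \oo] --> (0 : R).
  have k2 : 0 < 2 * kappa by rewrite mulr_gt0.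
  apply/norm_cvg0P.
  apply: squeeze_cvgr (cvgn_scale0 (C * kappa ^+ 2) (conc k2));
    last exact: cvg_cst.
  apply: filterS2 (nbhs_infty_gt 0) step => N N0 stepN; rewrite normr_ge0/=.
  rewrite (le_trans (gibbs_mean_norm _ _ _ _ _))// mulrA mulrAC -gibbs_meanZ.
  apply: gibbs_mean_le => X; rewrite (le_trans (stepN X))// mulrAC.
  apply: ler_wpM2l; first by rewrite divr_ge0 ?sqrtr_ge0 // mulr_ge0 // sqr_ge0.
  by rewrite ler_expR -mulrA ler_pM2l// ler_pM2l// norm_fluct_le.
have indF0 : kappa * (E (ind N) - normal_cdf sd (y' N)) @[N --> \oo] --> (0 :
  R).
  rewrite (_ : (fun N => _) = (fun N =>
      E (fun X : config q N => D N X - kappa * fluct X * g N (fluct X))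
      - E (fun X : config q N => D N X - kappa * fluct X * g N (fluct X)
           - kappa * (ind N X - normal_cdf sd (y' N))))).
    by rewrite -[X in _ --> X](subrr (0 : R)); exact: cvgB.
  apply/funext => N; rewrite -(gibbs_mean_cst p c beta h N (normal_cdf sd (y'
    N))).
  rewrite -!gibbs_meanB -gibbs_meanZ; congr (E _); apply/funext => X.
  by rewrite subKr gibbs_mean_cst.
have indF := cvgn_scale0 kappa^-1 indF0.
have Fy : normal_cdf sd (y' N) @[N --> \oo] --> normal_cdf sd x.
  apply: continuous_cvg y'x; apply: differentiable_continuous.
  by apply/derivable1_diffP; have [] := is_derive_normal_cdf sd_neq0 x.
rewrite (_ : (fun N => _) = (fun N => kappa^-1 *
    (kappa * (E (ind N) - normal_cdf sd (y' N))) + normal_cdf sd (y' N))).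
  by rewrite -[X in _ --> X]add0r; exact: cvgD.
by apply/funext => N; rewrite mulrA mulVf ?gt_eqF// mul1r subrK.
Qed.
End central_limit.

(** * The response of the mean to the field *)

Section tilting.
Context (R : realType) (p q : nat) (c : 'I_q) (beta h a : R) (N : nat).
Hypothesis N_gt0 : (0 < N)%N.
Local Notation E := (gibbs_mean p c beta h).
Let s := Num.sqrt N%:R : R.
Let N0 : 0 < N%:R :> R. Proof. by rewrite ltr0n. Qed.
Let s_gt0 : 0 < s. Proof. by rewrite sqrtr_gt0. Qed.
Let s2 : s ^+ 2 = N%:R. Proof. by rewrite sqr_sqrtr// ltW. Qed.

(** A change of the field by x / sqrt N is an exponential tilt of the
fluctuation. *)
Lemma gibbs_mean_tilt (x : R) (F : config q N -> R) :
  gibbs_mean p c beta (h + x / s) F =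
  E (fun X => F X * expR (x * fluct c a X))
    / E (fun X : config q N => expR (x * fluct c a X)).
Proof.
have wE (X : config q N) : gibbs_weight p c beta (h + x / s) X =
    gibbs_weight p c beta h X * expR (x * fluct c a X) * expR (x * s * a).
  rewrite /gibbs_weight -!expRD; congr expR; rewrite /fluct -/s -s2.
  by field; rewrite gt_eqF.
have Z0 := partition_gt0 p c beta h N.
set Z := \sum_(X : config q N) gibbs_weight p c beta h X in Z0.
have e0 := expR_gt0 (x * s * a).
have ME : E (fun X : config q N => expR (x * fluct c a X)) =
    (\sum_(X : config q N) gibbs_weight p c beta h X * expR (x * fluct c a X))
      / Z.
  by rewrite mulr_suml; apply: eq_bigr => X _; rewrite mulrAC.
have M0 : 0 < \sum_(X : config q N) gibbs_weight p c beta h X * expR (x * fluct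
  c a X).
  rewrite (bigD1 [ffun=> c])//= ltr_pwDl ?mulr_gt0 ?gibbs_weight_gt0
    ?expR_gt0//.
  by apply: sumr_ge0 => X _; rewrite mulr_ge0 ?expR_ge0// ltW//
    gibbs_weight_gt0.
rewrite ME /gibbs_mean mulr_suml; apply: eq_bigr => X _.
rewrite /gibbs wE; under eq_bigr do rewrite wE.
rewrite -mulr_suml -/Z; set M := \sum_(Y : config q N) _ in M0 *.
by field; rewrite !gt_eqF.
Qed.
End tilting.

Section mean_response.
Context (R : realType) (p q : nat) (c : 'I_q) (beta h a b : R).
Hypotheses (p_ge2 : (1 < p)%N) (q_ge2 : (1 < q)%N) (beta_ge0 : 0 <= beta).
Hypotheses (ab01 : [/\ 0 < a, a <= 1, 0 < b & b <= 1])
  (ab_sum : a + (q%:R - 1) * b = 1).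
Hypothesis stat :
  beta * p%:R * a ^+ (p - 1) + h - ln a = beta * p%:R * b ^+ (p - 1) - ln b.

Local Notation E := (gibbs_mean p c beta h).
Local Notation fluct := (fluct c a).
Context (kappa : R).
Hypothesis kappaE : curvature p q beta a b = kappa.
Hypothesis kappa_gt0 : 0 < kappa.
Hypothesis conc : forall L : R, 0 < L ->
  E (fun X : config q N => expR (L * dev (two_values c a b) X))
    / Num.sqrt N%:R @[N --> \oo] --> (0 : R).

Let stein := @cvg_stein R p q c beta h a b p_ge2 q_ge2 beta_ge0 ab01 ab_sum
  stat conc.

Let sqrt_ge1 (N : nat) : (0 < N)%N -> 1 <= Num.sqrt N%:R :> R.
Proof.
by move=> N0; rewrite -(@expr_ge1 _ 2) ?sqrtr_ge0// sqr_sqrtr// ler1n.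
Qed.

(** The Stein identity for g = 1. *)
Lemma cvg_mean_fluct :
  E (fun X : config q N => fluct X) @[N --> \oo] --> (0 : R).
Proof.
have hE : E (fun X : config q N => Num.sqrt N%:R * (1 - 1)
    - curvature p q beta a b * fluct X * 1) @[N --> \oo] --> (0 : R).
  apply: (stein (g := fun _ _ => 1) ler01 (lexx 0)); apply: nearW => N X.
  by rewrite subrr mulr0 normr0 normr1 mul0r expR0 mulr1.
rewrite (_ : (fun N => _) = fun N => - kappa^-1 *
    E (fun X : config q N => Num.sqrt N%:R * (1 - 1)
    - curvature p q beta a b * fluct X * 1)); first exact: cvgn_scale0.
apply/funext => N; rewrite -gibbs_meanZ; congr (E _); apply/funext => X.
by rewrite kappaE; field; rewrite gt_eqF.
Qed.

(** The backward difference quotient of w |-> exp (x w) with step 1 / sqrt N is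
this factor times the function itself. *)
Let slope (x : R) (N : nat) : R :=
  Num.sqrt N%:R * (1 - expR (- (x / Num.sqrt N%:R))).

Let slope_estimate (x : R) : exists2 K : R, 0 <= K &
  forall N, (0 < N)%N -> `|x - slope x N| <= K * (Num.sqrt N%:R)^-1.
Proof.
have [K K0 HK] := expR_remainder `|x|.
exists (K * x ^+ 2) => [|N N0]; first by rewrite mulr_ge0// sqr_ge0.
have s1 := sqrt_ge1 N0; have s0 : 0 < Num.sqrt N%:R :> R by exact: lt_le_trans
  s1.
have := HK (- (x / Num.sqrt N%:R)).
rewrite normrN normrM normfV (gtr0_norm s0) ler_pdivrMr// ler_peMr//.
move=> /(_ isT)/(ler_wpM2l (ltW s0)).
rewrite -[X in X * _ <= _ -> _](gtr0_norm s0) -normrM.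
rewrite /slope.
set s := Num.sqrt N%:R in s1 s0 *; set e := expR _.
rewrite (_ : s * (e - (1 - x / s)) = x - s * (1 - e)); last first.
  by field; rewrite gt_eqF.
rewrite (_ : s * (K * _) = K * x ^+ 2 / s)//.
by field; rewrite gt_eqF.
Qed.

(** The Stein identity for g w = exp (x w) says that the tilted mean of
kappa * W, multiplied by the normalization M, is x * M + o(1). Jensen's
inequality keeps M away from 0. *)
Lemma cvg_mean_response (x : R) :
  kappa * (Num.sqrt N%:R * (gibbs_mean p c beta (h + x / Num.sqrt N%:R)
    (fun X : config q N => color_freq R X c) - a)) @[N --> \oo] --> x.
Proof.
have [K K0 HK] := slope_estimate x.
have sV0 := @cvg_sqrtnV R.
have slope_cvg : slope x N @[N --> \oo] --> x.
  rewrite (_ : slope x = fun N => x - (x - slope x N)); last first.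
    by apply/funext => N; rewrite subKr.
  rewrite -[X in _ --> X]subr0; apply: cvgB; first exact: cvg_cst.
  apply/norm_cvg0P; apply: squeeze_cvgr (cvgn_scale0 K sV0);
    last exact: cvg_cst.
  by apply: filterS (nbhs_infty_gt 0) => N N0; rewrite normr_ge0 HK.
pose M N := E (fun X : config q N => expR (x * fluct X)).
pose A N := E (fun X : config q N => slope x N * expR (x * fluct X)
    - kappa * fluct X * expR (x * fluct X)).
have A0 : A N @[N --> \oo] --> (0 : R).
  have KL : 0 <= 1 + (`|x| + K) by rewrite !addr_ge0.
  have slopeE N w : Num.sqrt N%:R * (expR (x * w) - expR (x * (w - (Num.sqrt
    N%:R)^-1)))
      = slope x N * expR (x * w).
    rewrite /slope (_ : x * (w - _) = x * w + - (x / Num.sqrt N%:R));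
      last by ring.
    by rewrite expRD; ring.
  rewrite (_ : A = fun N => E (fun X : config q N => Num.sqrt N%:R *
      (expR (x * fluct X) - expR (x * (fluct X - (Num.sqrt N%:R)^-1)))
      - curvature p q beta a b * fluct X * expR (x * fluct X))); last first.
    apply/funext => N; rewrite /A kappaE; congr (E _).
    by apply/funext => X; rewrite slopeE.
  apply: (stein (g := fun _ w => expR (x * w)) KL (normr_ge0 x)).
  apply: filterS (nbhs_infty_gt 0) => N N0 X; rewrite slopeE.
  have expw : expR (x * fluct X) <= expR (`|x| * `|fluct X|).
    by rewrite ler_expR -normrM ler_norm.
  rewrite (normrM (slope x N)) !(ger0_norm (expR_ge0 _)); split.
    by rewrite (le_trans expw)// ler_peMl ?expR_ge0// lerDl addr_ge0.
  rewrite ler_pM ?expR_ge0//.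
  rewrite (_ : slope x N = x - (x - slope x N)); last by rewrite subKr.
  rewrite (le_trans (ler_normB _ _))// ler_wpDl// lerD2l (le_trans (HK _ N0))//.
  by rewrite ler_piMr// invf_le1 ?sqrt_ge1// (lt_le_trans _ (sqrt_ge1 N0)).
have M_ge : \forall N \near \oo, 2^-1 <= M N.
  have := cvgn_scale0 x cvg_mean_fluct => m0.
  have h2 : -2^-1 < 0 :> R by rewrite oppr_lt0 invr_gt0.
  apply: filterS (cvgr_ge 0 m0 _ h2) => N xN.
  apply: (@le_trans _ _ (E (fun X : config q N => 1 + x * fluct X))).
    rewrite gibbs_meanD gibbs_mean_cst gibbs_meanZ; lra.
  by apply: gibbs_mean_le => X; exact: expR_ge1Dx.
have AM0 : A N / M N @[N --> \oo] --> (0 : R).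
  have A2 : `|A N| @[N --> \oo] --> (0 : R) by apply/norm_cvg0P.
  apply/norm_cvg0P; apply: squeeze_cvgr (cvgn_scale0 2 A2); last exact: cvg_cst.
  apply: filterS M_ge => N MN; rewrite normr_ge0 normrM/= mulrC ler_wpM2r//.
  have M0 : 0 < M N by rewrite (lt_le_trans _ MN)// invr_gt0.
  by rewrite normfV (gtr0_norm M0) -[leRHS]invrK lef_pV2 ?posrE// invr_gt0.
rewrite -[X in _ --> X](subr0 x).
apply: cvg_trans (cvgB slope_cvg AM0); apply: near_eq_cvg.
apply: filterS2 (nbhs_infty_gt 0) M_ge => N N0 MN.
have M0 : 0 < M N by rewrite (lt_le_trans _ MN)// invr_gt0.
rewrite -[LHS]/(slope x N - A N / M N).
have -> : A N = slope x N * M N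
    - kappa * E (fun X : config q N => fluct X * expR (x * fluct X)).
  rewrite /A gibbs_meanB gibbs_meanZ; congr (_ - _).
  by rewrite -gibbs_meanZ; congr (E _); apply/funext => X; rewrite mulrA.
have -> : kappa * (Num.sqrt N%:R * (gibbs_mean p c beta (h + x / Num.sqrt N%:R)
    (fun X : config q N => color_freq R X c) - a)) =
  gibbs_mean p c beta (h + x / Num.sqrt N%:R) (fun X : config q N =>
    kappa * fluct X).
  by rewrite gibbs_meanZ gibbs_meanZ gibbs_meanB gibbs_mean_cst.
rewrite (gibbs_mean_tilt p c beta h a N0) -/(M N).
rewrite (_ : E (fun X : config q N => kappa * fluct X * _) =
    kappa * E (fun X : config q N => fluct X * expR (x * fluct X))); last first.
  by rewrite -gibbs_meanZ; congr (E _); apply/funext => X; rewrite mulrA.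
by field; rewrite gt_eqF.
Qed.
End mean_response.

(** * The free energy along the symmetric line *)

Section free_energy_line.
Context (R : realType) (p q : nat) (c : 'I_q) (beta h : R).
Hypothesis q_ge2 : (1 < q)%N.

Let Q : R := q%:R.
Let Q0 : 0 < Q. Proof. by rewrite ltr0n ltnW. Qed.
Let Q1 : 0 < Q - 1. Proof. by rewrite subr_gt0 ltr1n. Qed.

Definition line_a (u : R) : R := (1 + (q%:R - 1) * u) / q%:R.
Definition line_b (u : R) : R := (1 - u) / q%:R.

Lemma line_gt0 u : u \in `]- (q%:R - 1)^-1, 1[ -> 0 < line_a u /\ 0 < line_b u.
Proof.
rewrite in_itv/= => /andP[u0 u1]; rewrite /line_a /line_b !divr_gt0 ?subr_gt0//.
by move: u0; rewrite -(ltr_pM2l Q1) mulrN divff ?gt_eqF// /Q => ?; lra.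
Qed.

Lemma line_sum u : line_a u + (q%:R - 1) * line_b u = 1.
Proof. by rewrite /line_a /line_b; field; rewrite gt_eqF. Qed.

Lemma x_pointE u : x_point c u = two_values c (line_a u) (line_b u).
Proof. by []. Qed.

Let sum_two_values (a b : R) (g : R -> R) :
  \sum_(r < q) g (two_values c a b ord0 r) = g a + (Q - 1) * g b.
Proof.
rewrite (bigD1 c)//= mxE eqxx (eq_bigr (fun=> g b)); last first.
  by move=> r /negbTE rc; rewrite mxE rc.
by rewrite sumr_neq_const.
Qed.

Lemma f_lineE u : f_line p c beta h u =
  beta * (line_a u ^+ p + (q%:R - 1) * line_b u ^+ p) + h * line_a u
  - (line_a u * ln (line_a u) + (q%:R - 1) * (line_b u * ln (line_b u))).
Proof.
rewrite /f_line x_pointE /free_energy.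
rewrite (sum_two_values _ _ (fun x => x ^+ p)).
rewrite (sum_two_values _ _ (fun x => x * ln x)).
by rewrite !mxE eqxx.
Qed.

Let f1 (u : R) : R := (Q - 1) / Q *
  ((beta * p%:R * line_a u ^+ (p - 1) + h - ln (line_a u))
   - (beta * p%:R * line_b u ^+ (p - 1) - ln (line_b u))).

Let f2 (u : R) : R :=
  (Q - 1) / Q ^+ 2 *
  ((Q - 1) * (beta * p%:R * (p%:R - 1) * line_a u ^+ (p - 2) - (line_a u)^-1)
   + (beta * p%:R * (p%:R - 1) * line_b u ^+ (p - 2) - (line_b u)^-1)).

Let da (u : R) : is_derive u 1 line_a ((Q - 1) / Q).
Proof.
have -> : line_a = (fun v => Q^-1 + (Q - 1) / Q * v).
  by apply/funext => v; rewrite /line_a /Q; ring.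
apply: (is_derive_eq (is_derive_add (is_derive_cst Q^-1 u 1)
  (is_derive_scale (is_derive_id u 1) ((Q - 1) / Q)))).
by rewrite add0r mulr1.
Qed.

Let db (u : R) : is_derive u 1 line_b (- Q^-1).
Proof.
have -> : line_b = (fun v => Q^-1 + - Q^-1 * v).
  by apply/funext => v; rewrite /line_b /Q; ring.
apply: (is_derive_eq (is_derive_add (is_derive_cst Q^-1 u 1)
  (is_derive_scale (is_derive_id u 1) (- Q^-1)))).
by rewrite add0r mulr1.
Qed.

Let dln (f : R -> R) (u d : R) : 0 < f u -> is_derive u 1 f d ->
  is_derive u 1 (fun v => ln (f v)) ((f u)^-1 * d).
Proof.
by move=> fu fd; apply: (is_derive1_comp (is_derive1_ln fu) fd).
Qed.

Let df (u : R) : 0 < line_a u -> 0 < line_b u ->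
  is_derive u 1 (f_line p c beta h) (f1 u).
Proof.
move=> a0 b0; have -> : f_line p c beta h = (fun u =>
  beta * (line_a u ^+ p + (q%:R - 1) * line_b u ^+ p) + h * line_a u
  - (line_a u * ln (line_a u) + (q%:R - 1) * (line_b u * ln (line_b u)))).
  by apply/funext => v; exact: f_lineE.
apply: (is_derive_eq (is_derive_sub
  (is_derive_add (is_derive_scale (is_derive_add (is_derive_exprn (da u) p)
     (is_derive_scale (is_derive_exprn (db u) p) (q%:R - 1))) beta)
     (is_derive_scale (da u) h))
  (is_derive_add (is_derive_mul (da u) (dln a0 (da u)))
     (is_derive_scale (is_derive_mul (db u) (dln b0 (db u))) (q%:R - 1))))).
rewrite /f1 !subn1 -/Q.
move: (line_a u) (line_b u) a0 b0 => a b a0 b0.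
move: (a ^+ p.-1) (b ^+ p.-1) (ln a) (ln b) => ap bp la lb.
by field; rewrite !gt_eqF.
Qed.

Let df1 (u : R) : 0 < line_a u -> 0 < line_b u -> is_derive u 1 f1 (f2 u).
Proof.
move=> a0 b0.
apply: (is_derive_eq (is_derive_scale (is_derive_sub
   (is_derive_sub (is_derive_add
      (is_derive_scale (is_derive_exprn (da u) (p - 1)) (beta * p%:R))
      (is_derive_cst h u 1)) (dln a0 (da u)))
   (is_derive_sub (is_derive_scale (is_derive_exprn (db u) (p - 1)) (beta *
     p%:R))
      (dln b0 (db u)))) ((Q - 1) / Q))).
have pE (x : R) : beta * p%:R * ((p - 1)%:R * x ^+ (p - 1).-1) =
    beta * p%:R * (p%:R - 1) * x ^+ (p - 2).
  by rewrite -[LHS]mulrA natr_exprn_pred; ring.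
rewrite !(mulrA (beta * p%:R) _ (_ / _)) !(mulrA (beta * p%:R) _ (- _)) !pE /f2.
move: (line_a u) (line_b u) a0 b0 => a b a0 b0.
move: (a ^+ (p - 2)) (b ^+ (p - 2)) => ap bp.
by field; rewrite !gt_eqF.
Qed.

(** The interval extends to the left of 0 inside the simplex, so the maximum is
an interior one even for s = 0. *)
Lemma f_line_stationary s : s \in `]- (q%:R - 1)^-1, 1[ ->
  (forall t, simplex t ->
    free_energy p c beta h t <= free_energy p c beta h (x_point c s)) ->
  beta * p%:R * line_a s ^+ (p - 1) + h - ln (line_a s) =
  beta * p%:R * line_b s ^+ (p - 1) - ln (line_b s).
Proof.
move=> sI smax.
have N1 : - (Q - 1)^-1 <= 1 by rewrite (@le_trans _ _ 0)//
  oppr_le0 invr_ge0 ltW.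
have [_ f10] : is_derive s 1 (f_line p c beta h) 0.
  apply: (derive1_at_max N1 _ sI) => t /line_gt0[a0 b0].
    by have [] := df a0 b0.
  apply: smax; split => [r|].
    by rewrite x_pointE mxE; case: ifP => _; exact: ltW.
  by rewrite x_pointE (sum_two_values _ _ id) line_sum.
have [a0 b0] := line_gt0 sI; have [_ f1s] := df a0 b0.
have : f1 s = 0 by rewrite -f1s f10.
move/eqP; rewrite /f1 mulf_eq0 gt_eqF ?divr_gt0//= subr_eq0 => /eqP.
by [].
Qed.

Lemma f_line_second s : s \in `]- (q%:R - 1)^-1, 1[ ->
  - (q%:R ^+ 2 / (q%:R - 1) ^+ 2) * (f_line p c beta h)^`(2)%classic s =
  curvature p q beta (line_a s) (line_b s).
Proof.
move=> sI; have [a0 b0] := line_gt0 sI.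
have -> : (f_line p c beta h)^`(2)%classic s = f2 s.
  have [_ <-] := df1 a0 b0.
  rewrite /= derive1E; apply: near_eq_derive.
  have : \forall u \near s, u \in `]- (q%:R - 1)^-1, 1[.
    exact: near_in_itvoo.
  apply: filterS => u /line_gt0[ua ub]; rewrite derive1E.
  by have [] := df ua ub.
rewrite /f2 /curvature -/Q.
move: (line_a s) (line_b s) a0 b0 => a b a0 b0.
by field; rewrite !gt_eqF.
Qed.

(** Test the Hessian on the direction (q - 1, -1, ..., -1). *)
Lemma curvature_gt0 a b :
  (forall t : 'rV[R]_q, \sum_(r < q) t ord0 r = 0 -> t != 0 ->
     hessian_form p (two_values c a b) beta t < 0) ->
  0 < curvature p q beta a b.
Proof.
move=> neg; pose t := two_values c (Q - 1) (-1).
have := neg t; rewrite (sum_two_values _ _ id).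
rewrite mulrN1 subrr => /(_ erefl).
have tN0 : t != 0.
  apply/eqP => /rowP/(_ c); rewrite !mxE eqxx => Q10.
  by move: Q1; rewrite Q10 ltxx.
move=> /(_ tN0); rewrite /hessian_form (bigD1 c)//=.
rewrite (eq_bigr (fun=> beta * p%:R * (p%:R - 1) * b ^+ (p - 2) - b^-1)).
  rewrite sumr_neq_const !mxE eqxx.
  rewrite /curvature -/Q.
  set da' := _ - a^-1; set db' := _ - b^-1 => neg1.
  rewrite oppr_gt0 -(pmulr_rlt0 _ (exprn_gt0 2 Q1)).
  rewrite (_ : _ * _ = da' * (Q - 1) ^+ 2 + (Q - 1) * db')//.
  by field; rewrite gt_eqF.
move=> r /negbTE rc; rewrite !mxE rc.
by rewrite sqrrN expr1n mulr1.
Qed.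
End free_energy_line.

(** * The limit law of the estimator *)

(* normal_prob m sigma takes the standard deviation sigma, not the variance. *)
Theorem theorem3p1 (R : realType) (p q : nat) (hp : (2 <= p)%N)
  (hq : (2 <= q)%N) (c : 'I_q) (hc : c = 0%N :> nat)
  (beta h : R) (hbeta : 0 < beta) (hh : 0 <= h)
  (hreg : regular_point p c beta h)
  (s : R) (hs : 0 <= s < 1)
  (hm : unique_global_maximizer p c beta h (x_point c s)) :
  cvg_in_distribution
    (fun (N : nat) (X : config q N) => gibbs p c beta h X)
    (fun (N : nat) (X : config q N) =>
       ((Num.sqrt N%:R)%:E * (mle p c beta X - h%:E))%E)
    (normal_prob 0
       (Num.sqrt (- (q%:R ^+ 2 / (q%:R - 1) ^+ 2)
                  * (f_line p c beta h)^`(2)%classic s))).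
Proof.
have /andP[s0 s1] := hs.
have q1 : 0 < q%:R - 1 :> R by rewrite subr_gt0 ltr1n.
have sI : s \in `]- (q%:R - 1)^-1, 1[.
  by rewrite in_itv/= s1 andbT (lt_le_trans _ s0)// oppr_lt0 invr_gt0.
have [[_ smax] _] := hm.
have stat := f_line_stationary hq sI smax.
have [a0 b0] := line_gt0 hq sI; have ab := line_sum hq s.
rewrite (f_line_second p c beta h hq sI).
have hess (t : 'rV[R]_q) : \sum_(r < q) t ord0 r = 0 -> t != 0 ->
    hessian_form p (x_point c s) beta t < 0.
  have [m [[mmax _] mneg]] := hreg; have [_ munique] := hm.
  by rewrite -(munique m mmax); exact: mneg.
move: stat hm hess; rewrite x_pointE.
set a := line_a q s in a0 ab *; set b := line_b q s in b0 ab *.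
move=> stat m_max hess.
have kappa0 := curvature_gt0 hq hess.
have ab01 : [/\ 0 < a, a <= 1, 0 < b & b <= 1].
  split=> //; first by rewrite -ab lerDl mulr_ge0 ?ltW.
  rewrite -ab (@le_trans _ _ ((q%:R - 1) * b))// ?lerDr ?(ltW a0)//.
  by rewrite ler_peMl ?(ltW b0)// lerBrDr -[1 + 1]/(2%:R) ler_nat.
pose lam := beta * p%:R * b ^+ (p - 1) - ln b.
have m_gt0 r : 0 < two_values c a b ord0 r by rewrite mxE; case: ifP.
have m_stat r : beta * p%:R * two_values c a b ord0 r ^+ (p - 1)
    + h * (r == c)%:R - ln (two_values c a b ord0 r) = lam.
  by rewrite mxE /lam; case: eqP => _; rewrite ?mulr1 ?mulr0 ?addr0.
have [k k0 m_quad] := free_energy_quadratic m_max m_gt0 m_stat hess.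
have m_sum : \sum_(r < q) two_values c a b ord0 r =
  1 by have [[[_ ->]]] := m_max.
have conc := cvg_exp_dev (ltW hbeta) k0 m_gt0 m_sum m_stat m_quad.
set kappa := curvature p q beta a b in kappa0 *.
move=> x _.
suff : (\sum_(X : config q N | ((Num.sqrt N%:R)%:E * (mle p c beta X - h%:E)
      <= x%:E)%E) gibbs p c beta h X)%:E @[N --> \oo]
    --> (normal_cdf (Num.sqrt kappa) x)%:E by rewrite -normal_cdfE.
pose y N := kappa * (Num.sqrt N%:R * (gibbs_mean p c beta (h + x / Num.sqrt
  N%:R)
    (fun X : config q N => color_freq R X c) - a)).
have yx : y N @[N --> \oo] --> x.
  exact: (cvg_mean_response hp hq (ltW hbeta) ab01 ab stat erefl kappa0 conc).
have := cvg_cdf_fluct hp hq (ltW hbeta) ab01 ab stat erefl kappa0 conc yx.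
move=> lim; apply: cvg_EFin; first exact: nearW.
apply: cvg_trans lim; apply: near_eq_cvg.
apply: filterS (nbhs_infty_gt 0) => N N0 /=.
have N0R : 0 < Num.sqrt N%:R :> R by rewrite sqrtr_gt0 ltr0n.
rewrite [RHS]big_mkcond; apply: eq_bigr => X _.
have -> : ((Num.sqrt N%:R)%:E * (mle p c beta X - h%:E) <= x%:E)%E =
    (kappa * fluct c a X <= y N).
  transitivity (mle p c beta X <= (h + x / Num.sqrt N%:R)%:E)%E.
    case: (mle p c beta X) => [r||].
    - rewrite -EFinB -EFinM !lee_fin mulrC -ler_pdivlMr// lerBlDl//.
    - by rewrite addye// gt0_muley// lte_fin.
    - by rewrite addNye gt0_muleNy ?lte_fin// !leNye.
  rewrite mle_le// /y /fluct ler_pM2l// ler_pM2l// lerD2r.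
  by [].
by case: ifP => _; rewrite ?mulr1 ?mulr0.
Qed.
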